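(* Let $n\ge 1$, $1<p<\infty$, $1\le q<\infty$ and $0\le\lambda\le n$. Then the Hardy--Littlewood maximal operator $M$ is bounded on the Lorentz--Morrey space $\mathcal{L}_{p,q;\lambda}(\mathbb{R}^n)$; that is, there is a constant $C>0$, independent of $f$, such that $$\|Mf\|_{\mathcal{L}_{p,q;\lambda}(\mathbb{R}^n)}\le C\,\|f\|_{\mathcal{L}_{p,q;\lambda}(\mathbb{R}^n)}\quad\text{for all } f\in\mathcal{L}_{p,q;\lambda}(\mathbb{R}^n).$$
   Context: $B(x,r)$ is the open ball in $\mathbb{R}^n$ with center $x$ and radius $r$, and $|E|$ is Lebesgue measure. For $f\in L_1^{\rm loc}(\mathbb{R}^n)$, $Mf(x)=\sup_{r>0}|B(x,r)|^{-1}\int_{B(x,r)}|f(y)|\,dy$. The non-increasing rearrangement of a measurable $f$ is $f^*(t)=\inf\{\mu>0:\ |\{x:|f(x)|>\mu\}|\le t\}$, $t>0$. For $0<p,q<\infty$, $\|f\|_{L_{p,q}(\mathbb{R}^n)}=\left(\int_0^\infty (t^{1/p}f^*(t))^q\frac{dt}{t}\right)^{1/q}$. For $1\le p<\infty$, $0<q<\infty$, $0\le\lambda\le n$, the Lorentz--Morrey space $\mathcal{L}_{p,q;\lambda}(\mathbb{R}^n)$ is the set of all measurable functions $f$ on $\mathbb{R}^n$ with $$\|f\|_{\mathcal{L}_{p,q;\lambda}(\mathbb{R}^n)}:=\sup_{x\in\mathbb{R}^n,\ r>0} r^{-\lambda/p}\,\|f\chi_{B(x,r)}\|_{L_{p,q}(\mathbb{R}^n)}<\infty.$$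 *)

(* Defs.v *)
From HB Require Import structures.
From mathcomp Require Import all_boot all_order all_algebra.
From mathcomp Require Import all_classical all_reals all_analysis.
From mathcomp Require Import measurable_realfun.

Set Implicit Arguments.
Unset Strict Implicit.
Unset Printing Implicit Defensive.

Import Order.TTheory GRing.Theory Num.Theory.
Import numFieldNormedType.Exports.

Local Open Scope classical_set_scope.
Local Open Scope ring_scope.

(* Throughout, the space R^d with d >= 1 is 'rV[R]_n.+1, i.e. d = n.+1. *)

Section lebesgue_measure_rV.
Context {R : realType} (n : nat).
Implicit Types (a b : 'rV[R]_n.+1) (A : set 'rV[R]_n.+1).

Definition box a b : set 'rV[R]_n.+1 :=
  [set x | forall i, a 0 i < x 0 i <= b 0 i].

(* If b 0 i <= a 0 i for some i, the box is empty and its volume is 0. *)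
Definition box_volume a b : R := \prod_(i < n.+1) Num.max 0 (b 0 i - a 0 i).

Definition box_cover A : set ('rV[R]_n.+1 * 'rV[R]_n.+1)^nat :=
  [set c | A `<=` \bigcup_k box (c k).1 (c k).2].

Local Open Scope ereal_scope.

Definition lebesgue_outer A : \bar R :=
  ereal_inf [set \sum_(k <oo) (box_volume (c k).1 (c k).2)%:E
            | c in box_cover A].

Let box_volume_ge0 a b : 0 <= (box_volume a b)%:E.
Proof.
by rewrite lee_fin; apply: prodr_ge0 => i _; rewrite le_max lexx.
Qed.

Let lebesgue_outer_ge0 A : 0 <= lebesgue_outer A.
Proof.
by apply: le_ereal_inf_tmp => _ [c _ <-]; exact: nneseries_ge0.
Qed.

Let lebesgue_outer0 : lebesgue_outer set0 = 0.
Proof.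
apply/eqP; rewrite eq_le lebesgue_outer_ge0 andbT.
apply: ereal_inf_lbound; exists (fun=> (0%R, 0%R)) => //.
apply: eseries0 => k _ _.
by rewrite /box_volume big_ord_recl subrr maxxx mul0r.
Qed.

Let le_lebesgue_outer : {homo lebesgue_outer : A B / A `<=` B >-> A <= B}.
Proof.
move=> A B AB; apply: ereal_inf_le_tmp => _ [c Bc <-].
by exists c => //; exact: subset_trans AB Bc.
Qed.

Let lebesgue_outer_sigma_subadditive : sigma_subadditive lebesgue_outer.
Proof.
move=> A; have [[i ioo]|] := pselect (exists i, lebesgue_outer (A i) = +oo).
  rewrite (eseries_pinfty _ _ ioo) ?leey// => k _.
  by rewrite -ltNye (lt_le_trans _ (lebesgue_outer_ge0 _)).
rewrite -forallNE => Aoo.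
pose vol (u : 'rV[R]_n.+1 * 'rV[R]_n.+1) := (box_volume u.1 u.2)%:E.
suff add2e (e : {posnum R}) : lebesgue_outer (\bigcup_n A n) <=
    \sum_(i <oo) lebesgue_outer (A i) + e%:num%:E.
  by apply/lee_addgt0Pr => _/posnumP[].
rewrite (le_trans _ (epsilon_trick _ _ _))//.
pose P k c := box_cover (A k) c /\ \sum_(j <oo) vol (c j) <=
  lebesgue_outer (A k) + (e%:num / (2 ^ k.+1)%:R)%:E.
have [G PG] : {G : ((_ : Type)^nat)^nat & forall k, P k (G k)}.
  apply: (@choice _ _ P) => k; rewrite /P.
  have ek : (0 < e%:num / (2 ^ k.+1)%:R)%R by [].
  have Afin : lebesgue_outer (A k) \is a fin_num.
    by rewrite ge0_fin_numE// ltey; exact/eqP/Aoo.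
  have [_ [c Ac <-] cA] := lb_ereal_inf_adherent ek Afin.
  by exists c; split => //; exact: ltW.
have volG_ge0 x : 0 <= (vol \o uncurry G) x by exact: box_volume_ge0.
apply: (@le_trans _ _ (\esum_(i in setT) (vol \o uncurry G) i)).
  apply: ereal_inf_lbound => /=.
  have /card_esym/ppcard_eqP[f] := card_nat2.
  exists (uncurry G \o f).
    move=> t [i _ /(PG i).1 [j _ Gt]].
    by exists (f^-1%FUN (i, j)) => //=; rewrite invK ?inE.
  rewrite -(esum_pred_image (vol \o uncurry G) _ xpredT) ?[fun=> _]set_true//.
  by rewrite image_eq.
rewrite (_ : esum _ _ = \sum_(i <oo) \sum_(j <oo) vol (G i j)); last first.
  pose J : nat -> set (nat * nat) := fun i => [set (i, j) | j in setT].
  rewrite (_ : setT = \bigcup_k J k); last first.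
    by rewrite predeqE => -[a b]; split => // _; exists a => //; exists b.
  rewrite esum_bigcupT /=; last 2 first.
    - apply/trivIsetP => i j _ _ ij.
      rewrite predeqE => -[x y] /=; split => //= -[] [_] _ [<-{x} _].
      by move=> [y' _] [] /esym/eqP; rewrite (negbTE ij).
    - by move=> x; exact: volG_ge0.
  rewrite -(image_id [set: nat]) -fun_true esum_pred_image//; last first.
    by move=> k _; apply: esum_ge0 => x _; exact: volG_ge0.
  apply: eq_eseriesr => /= j _.
  rewrite -(esum_pred_image (vol \o uncurry G) (pair j) predT)//=; last 2 first.
  - by move=> k _; exact: (volG_ge0 (j, k)).
  - by move=> ? ? _ _; exact: (@can_inj _ _ _ snd).
  by congr esum; rewrite predeqE => -[a b]; split; move=> [i _ <-]; exists i.
apply: lee_nneseries => k *; last exact: (PG k).2.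
by apply: nneseries_ge0 => j *; exact: (volG_ge0 (k, j)).
Qed.

HB.instance Definition _ := isOuterMeasure.Build R 'rV[R]_n.+1 lebesgue_outer
  lebesgue_outer0 lebesgue_outer_ge0 le_lebesgue_outer
  lebesgue_outer_sigma_subadditive.

End lebesgue_measure_rV.

(* R^n.+1 with the sigma-algebra of Lebesgue (not merely Borel) measurable
   sets; the restriction of lebesgue_outer to it is canonically a measure. *)
Notation lebesgue_rV R n := (caratheodory_type (@lebesgue_outer R n)).

Definition lebesgue_measure_rV {R : realType} {n : nat} :
  set (lebesgue_rV R n) -> \bar R := @lebesgue_outer R n.

HB.instance Definition _ (R : realType) (n : nat) :=
  Measure.copy (@lebesgue_measure_rV R n)
    ((@lebesgue_outer R n : {outer_measure set 'rV[R]_n.+1 -> \bar R})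
      : set (lebesgue_rV R n) -> \bar R).

(* The library's ball on 'rV[R]_n.+1 is the one of the sup norm. *)
Definition eball {R : realType} {n : nat} (x : 'rV[R]_n.+1) (r : R) :
    set (lebesgue_rV R n) :=
  [set y : 'rV[R]_n.+1 | Num.sqrt (\sum_(i < n.+1) (y 0 i - x 0 i) ^+ 2) < r].

Section lorentz_morrey.
Context {R : realType} {n : nat}.
Local Notation E := (lebesgue_rV R n).
Local Notation mu := (@lebesgue_measure_rV R n).
Implicit Types (f : E -> \bar R) (p q lam : R).
Local Open Scope ereal_scope.

(* Analogue in R^n.+1 of HL_maximal. *)
Definition HL_maximal_rV f (x : E) : \bar R :=
  ereal_sup [set (fine (mu (eball x r)))^-1%:E *
                 \int[mu]_(y in eball x r) `|f y| | r in `]0%R, +oo[].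

Definition rearrangement f (t : R) : \bar R :=
  ereal_inf [set m%:E | m in
    [set m : R | (0 < m)%R /\ mu [set x | m%:E < `|f x|] <= t%:E]].

Definition lorentz_norm p q f : \bar R :=
  (\int[@lebesgue_measure R]_(t in `]0%R, +oo[)
     (((t `^ p^-1)%:E * rearrangement f t) `^ q * t^-1%:E)) `^ q^-1.

Definition lorentz_morrey_norm p q lam f : \bar R :=
  ereal_sup [set (r `^ (- (lam / p)))%:E * lorentz_norm p q (f \_ (eball x r))
            | x in [set: E] & r in `]0%R, +oo[].

Definition lorentz_morrey p q lam : set (E -> \bar R) :=
  [set f : E -> \bar R |
    measurable_fun [set: E] f /\ lorentz_morrey_norm p q lam f < +oo].

End lorentz_morrey.

(* Main.v *)
Require Import Defs.
From mathcomp Require Import all_boot all_order all_algebra.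
From mathcomp Require Import all_classical all_reals all_analysis.
From mathcomp Require Import measurable_realfun.
From mathcomp Require Import ring lra.
Set Implicit Arguments.
Unset Strict Implicit.
Unset Printing Implicit Defensive.
Import Order.TTheory GRing.Theory Num.Theory.
Import numFieldNormedType.Exports.
Local Open Scope classical_set_scope.
Local Open Scope ring_scope.

(** The maximal operator is of weak type (1,1) by the Vitali covering argument.
    Applying this to the part of g above a level A, with
    A > sup_k b^-k g*(2^-k t), yields the pointwise rearrangement bound
    (Mg)*(ct) <= 2 sup_k b^-k g*(2^-k t) for any 1 < b < 2. Taking
    2^(1/p) < b < 2 and using the invariance of dt/t under dilations, M is
    bounded on L_(p,q) by a convergent geometric series. On a ball B of radius r,
    Mf is at most the maximum of M(f 1_2B) and of the means of |f| over balls of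
    radius s > r; the latter are O(s^((lam - n)/p)) by the Hölder inequality for
    L_(p,q), hence O(r^((lam - n)/p)) because lam <= n. *)

(** The base [b] answers two opposite demands. The layer of |g| above the level b^k A has measure at
    most t/2^k, so the layer series for the integral above A has ratio b/2 and calls for b < 2; the
    dilate by 2^-k enters the Lorentz integral with weight (2^(1/p)/b)^(kq), which calls for b >
    2^(1/p). Both can be met exactly when p > 1. The integral above A is bounded by a multiple of A
    t, so A cancels in the weak type inequality and only a fixed dilation of t remains.

    For general exponents [lorentz_norm] is only a quasi-norm. This is why suprema and maxima of
    rearrangements are kept until the power q has been taken, and only then bounded by sums of
    nonnegative terms.

    One layer estimate, [integral_superlevel_le], serves three times: for M, for the means over
    balls, and for the integrability of t^(a-1) near 0. Since the norms are extended reals, bounds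
    are proved for each real number strictly above the norm and passed to the norm at the end. *)

(** * The Euclidean norm on row vectors *)

Section euclidean_norm.
Context {R : realType} {m : nat}.
Implicit Types x y z : 'rV[R]_m.

Definition enorm x : R := Num.sqrt (\sum_(i < m) (x 0 i) ^+ 2).

Lemma enorm_ge0 x : 0 <= enorm x. Proof. exact: sqrtr_ge0. Qed.

Lemma sqr_enorm x : enorm x ^+ 2 = \sum_(i < m) (x 0 i) ^+ 2.
Proof. by rewrite sqr_sqrtr// sumr_ge0// => i _; rewrite sqr_ge0. Qed.

Lemma enormZ (a : R) x : enorm (a *: x) = `|a| * enorm x.
Proof.
apply/eqP; rewrite -(@eqrXn2 _ 2%N)// ?enorm_ge0 ?mulr_ge0 ?enorm_ge0//.
rewrite exprMn !sqr_enorm mulr_sumr real_normK ?num_real//.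
by apply/eqP/eq_bigr => i _; rewrite !mxE exprMn.
Qed.

Lemma enorm_opp x : enorm (- x) = enorm x.
Proof. by rewrite -scaleN1r enormZ normrN1 mul1r. Qed.

Lemma enorm_subC x y : enorm (x - y) = enorm (y - x).
Proof. by rewrite -enorm_opp opprB. Qed.

Lemma cauchy_schwarz x y : \sum_i x 0 i * y 0 i <= enorm x * enorm y.
Proof.
have [x0|x0] := eqVneq (enorm x) 0.
  rewrite x0 mul0r big1// => i _; apply/eqP; rewrite mulf_eq0; apply/orP; left.
  have /eqP := sqr_enorm x; rewrite x0 expr0n/= eq_sym psumr_eq0.
    by move=> /allP/(_ i); rewrite mem_index_enum sqrf_eq0; exact.
  by move=> j _; rewrite sqr_ge0.
have [y0|y0] := eqVneq (enorm y) 0.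
  rewrite y0 mulr0 big1// => i _; apply/eqP; rewrite mulf_eq0; apply/orP; right.
  have /eqP := sqr_enorm y; rewrite y0 expr0n/= eq_sym psumr_eq0.
    by move=> /allP/(_ i); rewrite mem_index_enum sqrf_eq0; exact.
  by move=> j _; rewrite sqr_ge0.
have ab0 : 0 < enorm x * enorm y by rewrite mulr_gt0// lt0r ?x0 ?y0 enorm_ge0.
set a := enorm x in ab0 *; set b := enorm y in ab0 *; set S := \sum_i _.
(* With [a] and [b] the two norms, this sum equals 2 a b (a b - S), so dividing by a b > 0 gives the
   claim. *)
have : 0 <= \sum_i (b * x 0 i - a * y 0 i) ^+ 2.
  by rewrite sumr_ge0// => i _; rewrite sqr_ge0.
have -> : \sum_i (b * x 0 i - a * y 0 i) ^+ 2
    = b ^+ 2 * a ^+ 2 - 2 * (a * b) * S + a ^+ 2 * b ^+ 2.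
  have -> : b ^+ 2 * a ^+ 2 = \sum_i b ^+ 2 * x 0 i ^+ 2.
    by rewrite -mulr_sumr -sqr_enorm.
  have -> : a ^+ 2 * b ^+ 2 = \sum_i a ^+ 2 * y 0 i ^+ 2.
    by rewrite -mulr_sumr -sqr_enorm.
  rewrite /S mulr_sumr -sumrB -big_split/=.
  by apply: eq_bigr => i _; ring.
move=> h; rewrite -(ler_pM2l ab0); nra.
Qed.

Lemma enormD x y : enorm (x + y) <= enorm x + enorm y.
Proof.
rewrite -(@ler_pXn2r _ 2%N)// ?nnegrE ?addr_ge0 ?enorm_ge0//.
rewrite sqr_enorm sqrrD !sqr_enorm.
under eq_bigr do rewrite !mxE sqrrD.
rewrite !big_split/= lerD2r lerD2l.
by rewrite mulr2n lerD// cauchy_schwarz.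
Qed.

Lemma enorm_triangle x y z : enorm (x - z) <= enorm (x - y) + enorm (y - z).
Proof. by rewrite (le_trans _ (enormD _ _))// addrA subrK. Qed.

Lemma le_enorm x i : `|x 0 i| <= enorm x.
Proof.
rewrite -(@ler_pXn2r _ 2%N)// ?nnegrE ?enorm_ge0// sqr_enorm.
rewrite real_normK ?num_real// (bigD1 i)//= lerDl.
by rewrite sumr_ge0// => j _; rewrite sqr_ge0.
Qed.

Lemma enorm_le_sum x : enorm x <= \sum_i `|x 0 i|.
Proof.
have s0 : 0 <= \sum_i `|x 0 i| by rewrite sumr_ge0.
rewrite -(@ler_pXn2r _ 2%N)// ?nnegrE ?enorm_ge0// sqr_enorm expr2 mulr_suml.
apply: ler_sum => i _; rewrite -real_normK ?num_real// expr2 ler_wpM2l//.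
by rewrite (bigD1 i)//= lerDl sumr_ge0.
Qed.

End euclidean_norm.

(** * The outer measure under affine maps and under cuts by hyperplanes *)

Section lebesgue_outer_affine.
Context {R : realType} {n : nat}.
Local Notation V := 'rV[R]_n.+1.
Implicit Types (a b x : V) (A : set V).

Lemma box_volume_ge0 a b : 0 <= box_volume a b.
Proof. by apply: prodr_ge0 => i _; rewrite le_max lexx. Qed.

Lemma box_volume_affine (r : R) x a b : 0 < r ->
  box_volume (x + r *: a) (x + r *: b) = r ^+ n.+1 * box_volume a b.
Proof.
move=> r0; have -> : r ^+ n.+1 = \prod_(i < n.+1) r by rewrite prodr_const card_ord.
rewrite /box_volume -big_split/=; apply: eq_bigr => i _; rewrite !mxE.
rewrite maxr_pMr ?ltW// mulr0; congr Num.max; ring.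
Qed.

Local Open Scope ereal_scope.

(** The cover consists of the box itself followed by empty boxes. The bound serves to show that
    balls have finite measure. *)
Lemma lebesgue_outer_box a b : lebesgue_outer (box a b) <= (box_volume a b)%:E.
Proof.
apply: ereal_inf_lbound.
exists (fun k : nat => if k == 0%N then (a, b) else (0%R, 0%R)).
  by move=> y aby; exists 0%N.
rewrite (nneseries_split 0%N 1%N); last first.
  by move=> k _; rewrite lee_fin box_volume_ge0.
rewrite add0n big_nat1/= eseries0 ?adde0// => -[//|k] _ _ /=.
by rewrite /box_volume big_ord_recl subrr maxxx mul0r.
Qed.

Lemma lebesgue_outer_affine_le (r : R) x A : (0 < r)%R ->
  lebesgue_outer [set (x + r *: y)%R | y in A] <=
    (r ^+ n.+1)%:E * lebesgue_outer A.
Proof.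
move=> r0; have rn0 : (0 < r ^+ n.+1)%R by rewrite exprn_gt0.
rewrite -lee_pdivrMl//; apply: le_ereal_inf_tmp => _ [c Ac <-].
rewrite lee_pdivrMl//; apply: ereal_inf_lbound.
exists (fun k => ((x + r *: (c k).1)%R, (x + r *: (c k).2)%R)).
  move=> _ [y /Ac[k _ ky] <-]; exists k => // i; rewrite !mxE.
  by rewrite ltrD2l ltr_pM2l// lerD2l ler_pM2l//; exact: ky.
rewrite -nneseriesZl//=; last by move=> k _; rewrite lee_fin box_volume_ge0.
by apply: eq_eseriesr => k _; rewrite box_volume_affine.
Qed.

(** The missing inequality is the previous lemma applied to the inverse map, which sends y to r^-1 y
    - r^-1 x. *)
Lemma lebesgue_outer_affine (r : R) x A : (0 < r)%R ->
  lebesgue_outer [set (x + r *: y)%R | y in A] =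
    (r ^+ n.+1)%:E * lebesgue_outer A.
Proof.
move=> r0; apply/eqP; rewrite eq_le lebesgue_outer_affine_le//=.
have rn0 : (0 < r ^+ n.+1)%R by rewrite exprn_gt0.
rewrite -lee_pdivlMl// -exprVn.
have ri0 : (0 < r^-1)%R by rewrite invr_gt0.
apply: le_trans (lebesgue_outer_affine_le (- (r^-1 *: x)) _ ri0).
apply: (@le_outer_measure _ _ (@lebesgue_outer R n)) => y Ay /=.
exists (x + r *: y)%R; first by exists y.
by rewrite scalerDr scalerA mulVf ?gt_eqF// scale1r addrA addNr add0r.
Qed.

Lemma interval_length_split (a b s : R) :
  (Num.max 0 (b - a) = Num.max 0 (Num.min b s - a) + Num.max 0 (b - Num.max a s))%R.
Proof.
have [bs|sb] := leP b s; have [a_s|sa] := leP a s.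
- by rewrite [X in (_ = _ + X)%R]max_l ?addr0//; lra.
- by rewrite [X in (_ = _ + X)%R]max_l ?addr0//; lra.
- rewrite !max_r; lra.
- by rewrite [X in (_ = X + _)%R]max_l ?add0r//; lra.
Qed.

Lemma box_volume_split (i : 'I_n.+1) (s : R) a b :
  (box_volume a b = box_volume a (\row_j if j == i then Num.min (b 0 j) s else b 0 j)
   + box_volume (\row_j if j == i then Num.max (a 0 j) s else a 0 j) b)%R.
Proof.
have D1 F : (\prod_(j < n.+1) F j = F i * \prod_(j < n.+1 | j != i) F j :> R)%R.
  exact: bigD1.
rewrite /box_volume !D1 !mxE eqxx.
under [in X in (_ = _ * X + _)%R]eq_bigr do rewrite !mxE ifN//.
under [in X in (_ = _ + _ * X)%R]eq_bigr do rewrite !mxE ifN//.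
rewrite -mulrDl; congr *%R.
exact: interval_length_split.
Qed.

(** Cutting every box of a cover of X along the hyperplane gives covers of both parts of X without
    changing the total volume. The closed condition [<= s] fits boxes that are open below and closed
    above, so both halves are again boxes. *)
Lemma halfspace_caratheodory (i : 'I_n.+1) (s : R) :
  (@lebesgue_outer R n).-caratheodory [set y : V | (y 0 i <= s)%R].
Proof.
apply: le_caratheodory_measurable => X.
set H := [set _ | _].
apply: le_ereal_inf_tmp => _ [c Xc <-].
pose c1 k : V * V :=
  ((c k).1, \row_j if j == i then Num.min ((c k).2 0 j) s else (c k).2 0 j)%R.
pose c2 k : V * V :=
  (\row_j if j == i then Num.max ((c k).1 0 j) s else (c k).1 0 j, (c k).2)%R.
under eq_eseriesr do rewrite (box_volume_split i s) EFinD.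
rewrite nneseriesD; [|by move=> k _ _; rewrite lee_fin box_volume_ge0..].
apply: leeD; apply: ereal_inf_lbound.
  exists c1 => // y [/Xc[k _ ky] Hy]; exists k => // j; rewrite mxE /=.
  have /andP[-> /= kj] := ky j; case: eqP => // ->.
  by rewrite le_min Hy andbT; have /andP[] := ky i.
exists c2 => // y [/Xc[k _ ky] /negP]; rewrite -ltNge => Hy.
exists k => // j; rewrite mxE /=.
have /andP[kj ->] := ky j; rewrite andbT; case: eqP => // ji.
by rewrite gt_max kj ji.
Qed.

End lebesgue_outer_affine.

(** * Measurability and volume of Euclidean balls *)

Section euclidean_balls.
Context {R : realType} {n : nat}.
Local Notation V := 'rV[R]_n.+1.
Local Notation E := (lebesgue_rV R n).
Local Notation mu := (@lebesgue_measure_rV R n).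
Implicit Types x y : V.

Lemma eballE x r : eball x r = [set y : V | enorm (y - x) < r].
Proof.
have E y : enorm (y - x) = Num.sqrt (\sum_(i < n.+1) (y 0 i - x 0 i) ^+ 2).
  by rewrite /enorm; under eq_bigr do rewrite !mxE.
by apply/seteqP; split => y; rewrite /eball/= E.
Qed.

Lemma measurable_coord (i : 'I_n.+1) :
  measurable_fun [set: E] ((fun y : V => y 0 i) : E -> R).
Proof.
apply: (measurability _ (RGenInftyO.measurableE R)) => _ [_ [s ->] <-].
rewrite setTI.
have -> : (fun y : V => y 0 i) @^-1` `]-oo, s[ =
    \bigcup_k [set y : V | y 0 i <= s - k.+1%:R^-1].
  apply/seteqP; split => [y|y [k _]] /=; rewrite in_itv/=.
    move=> ys; have [k ks] := ltr_add_invr ys; exists k => //=.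
    by rewrite lerBrDr ltW.
  by move=> /le_lt_trans; apply; rewrite ltrBlDr ltrDl invr_gt0.
apply: bigcupT_measurable => k; exact: halfspace_caratheodory.
Qed.

Lemma measurable_eball x r : measurable (eball x r).
Proof.
have mf : measurable_fun [set: E]
    ((fun y : V => Num.sqrt (\sum_(i < n.+1) (y 0 i - x 0 i) ^+ 2)) : E -> R).
  apply: (measurableT_comp (continuous_measurable_fun (@sqrt_continuous R))).
  apply: measurable_sum => i; apply: measurable_funX.
  exact: (measurable_funB (measurable_coord i) (measurable_cst (x 0 i))).
rewrite -[eball x r]setTI.
have mr : measurable_fun [set: E] (fun=> r) by exact: measurable_cst.
exact: (measurable_fun_ltr mf mr) measurableT [set true] I.
Qed.

Local Open Scope ereal_scope.

Lemma mu_eball x r : (0 < r)%R ->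
  mu (eball x r) = (r ^+ n.+1)%:E * mu (eball (0 : V) 1).
Proof.
move=> r0; rewrite /lebesgue_measure_rV -(lebesgue_outer_affine x _ r0).
congr lebesgue_outer; rewrite !eballE; apply/seteqP; split => y /=.
  move=> xyr; exists (r^-1 *: (y - x))%R; rewrite /=.
    by rewrite subr0 enormZ gtr0_norm ?invr_gt0// ltr_pdivrMl// mulr1.
  by rewrite scalerA divff ?gt_eqF// scale1r addrC subrK.
move=> [z]; rewrite subr0 => z1 <-.
by rewrite addrAC subrr add0r enormZ gtr0_norm// gtr_pMr.
Qed.

Lemma mu_eball_fin x r : mu (eball x r) \is a fin_num.
Proof.
rewrite ge0_fin_numE ?measure_ge0//.
apply: (@le_lt_trans _ _ (lebesgue_outer (box (x - const_mx r) (x + const_mx r)))).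
  apply: (@le_outer_measure _ _ (@lebesgue_outer R n)) => y.
  rewrite eballE/= => xyr i; rewrite !mxE.
  have := le_lt_trans (le_enorm (y - x)%R i) xyr; rewrite !mxE ltr_norml.
  by move=> /andP[? ?]; apply/andP; split; lra.
by apply: le_lt_trans (lebesgue_outer_box _ _) _; rewrite ltry.
Qed.

Lemma eball_subset x y r s : (enorm (x - y) + r <= s)%R ->
  eball x r `<=` eball y s.
Proof.
move=> xyrs z; rewrite !eballE/= => zx; apply: lt_le_trans xyrs.
by rewrite (le_lt_trans (enorm_triangle z x y))// addrC ltrD2l.
Qed.

Lemma rat_dense (x : V) (e : R) : (0 < e)%R ->
  exists c : 'rV[rat]_n.+1, (enorm (x - map_mx ratr c) < e)%R.
Proof.
move=> e0; have d0 : (0 < e / n.+1%:R)%R by rewrite divr_gt0.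
have /choice[c cP] : forall i : 'I_n.+1, exists q : rat,
    (`|x 0 i - ratr q| < e / n.+1%:R)%R.
  move: (e / _)%R d0 => d d0 i.
  have xd : (x 0 i - d < x 0 i + d)%R by rewrite ltrBlDr -addrA ltrDl addr_gt0.
  have [q] := rat_in_itvoo xd.
  rewrite in_itv/= => /andP[q1 q2]; exists q; rewrite ltr_norml.
  by apply/andP; split; lra.
exists (\row_i c i); apply: le_lt_trans (enorm_le_sum _) _.
apply: (@lt_le_trans _ _ (\sum_(i < n.+1) e / n.+1%:R)%R).
  apply: ltr_sum => [|i _]; first by apply/hasP; exists ord0; rewrite ?mem_index_enum.
  by rewrite !mxE; exact: cP.
by rewrite sumr_const card_ord -[leLHS]mulr_natr divfK.
Qed.

(* A is a countable union of balls with rational centers and radii. *)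
Lemma open_eball_measurable (A : set V) :
  (forall x, A x -> exists2 e : R, (0 < e)%R & eball x e `<=` A) ->
  measurable (A : set E).
Proof.
move=> Ao.
pose F (cr : 'rV[rat]_n.+1 * rat) : set E :=
  eball (map_mx ratr cr.1 : V) (ratr cr.2).
pose D := [set cr | F cr `<=` A].
suff -> : A = \bigcup_(cr in D) F cr.
  rewrite bigcup_mkcond; apply: countable_bigcupT_measurable => // cr.
  by case: ifP => // _; exact: measurable_eball.
apply/seteqP; split => [x Ax|x [cr Dcr] /Dcr//].
have [e e0 eA] := Ao _ Ax.
have e2 : (0 < e / 2)%R by rewrite divr_gt0.
have [q] := rat_in_itvoo e2.
rewrite in_itv/= => /andP[q0 qe].
have [c xc] := rat_dense x q0.
exists (c, q); last by rewrite /F eballE.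
rewrite /D/=; apply: subset_trans eA; apply: eball_subset => /=.
by rewrite enorm_subC; lra.
Qed.

End euclidean_balls.

(** * Measurability and weak type (1,1) of the maximal function *)

Section maximal_function.
Context {R : realType} {n : nat}.
Local Notation V := 'rV[R]_n.+1.
Local Notation E := (lebesgue_rV R n).
Local Notation mu := (@lebesgue_measure_rV R n).
Implicit Types (f g : E -> \bar R) (x y : V) (r a : R).
Local Open Scope ereal_scope.

Lemma le_lebesgue_measure_rV (A B : set E) : A `<=` B -> mu A <= mu B.
Proof.
move=> AB; rewrite /lebesgue_measure_rV.
exact: (@le_outer_measure R V (@lebesgue_outer R n) A B AB).
Qed.

Definition ball_volume r : R := (r ^+ n.+1 * fine (mu (eball (0 : V) 1)))%R.

(* Were this measure 0, the maximal function would vanish (0^-1 = 0), so the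
   positivity never has to be proved: see [HL_maximal_null]. *)
Hypothesis unit_ball_gt0 : (0 < fine (mu (eball (0 : V) 1)))%R.

Lemma mu_eballE x r : (0 < r)%R -> mu (eball x r) = (ball_volume r)%:E.
Proof. by move=> r0; rewrite mu_eball// EFinM fineK// mu_eball_fin. Qed.

Lemma ball_volume_gt0 r : (0 < r)%R -> (0 < ball_volume r)%R.
Proof. by move=> r0; rewrite mulr_gt0// exprn_gt0. Qed.

Lemma ball_volumeM r s : ball_volume (r * s) = (r ^+ n.+1 * ball_volume s)%R.
Proof. by rewrite /ball_volume exprMn mulrA. Qed.

Lemma HL_maximal_leP f x a : HL_maximal_rV f x <= a%:E <->
  forall r, (0 < r)%R -> \int[mu]_(y in eball x r) `|f y| <= (a * ball_volume r)%:E.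
Proof.
split=> [h r r0|h].
  have v0 := ball_volume_gt0 r0.
  rewrite mulrC EFinM -lee_pdivrMl//; apply: le_trans h; apply: ereal_sup_ubound.
  by exists r => /=; [rewrite in_itv/= r0|rewrite mu_eballE].
apply: ge_ereal_sup => _ [r /= r0 <-].
move: r0; rewrite in_itv/= andbT => r0.
rewrite mu_eballE//= lee_pdivrMl ?ball_volume_gt0// -EFinM mulrC.
exact: h.
Qed.

Lemma HL_maximal_gtP f x a : a%:E < HL_maximal_rV f x <->
  exists2 r, (0 < r)%R & (a * ball_volume r)%:E < \int[mu]_(y in eball x r) `|f y|.
Proof.
split=> [ax|[r r0 ar]].
  apply: contrapT => /forall2NP h; move: ax; apply/negP; rewrite -leNgt.
  apply/HL_maximal_leP => r r0; rewrite leNgt; apply/negP.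
  by case: (h r).
by rewrite ltNge; apply/negP => /HL_maximal_leP/(_ _ r0); rewrite leNgt ar.
Qed.

Lemma HL_maximal_ge0 f x : 0 <= HL_maximal_rV f x.
Proof.
have mem1 : [set (fine (mu (eball x r)))^-1%:E * \int[mu]_(y in eball x r) `|f y|
    | r in `]0%R, +oo[] ((fine (mu (eball x 1)))^-1%:E * \int[mu]_(y in eball x 1) `|f y|).
  by exists 1%R => //=; rewrite in_itv/= ltr01.
apply: le_trans (ereal_sup_ubound mem1).
rewrite mule_ge0 ?integral_ge0// lee_fin invr_ge0 fine_ge0//.
Qed.

(** A strict inequality leaves room to enlarge the radius a little. This room pays for moving the
    centre of a ball in [HL_maximal_gt_open]. *)
Lemma ball_volume_right_cont r (m : \bar R) a : (0 < r)%R ->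
  (a * ball_volume r)%:E < m ->
  exists2 s, (r < s)%R & forall s', (r < s' < s)%R -> (a * ball_volume s')%:E < m.
Proof.
move=> r0.
have fct : ((a * ball_volume s)%R @[s --> r] --> (a * ball_volume r)%R).
  by apply: cvgMr; apply: cvgMl; exact: exprn_continuous.
case: m => [m| |//].
  rewrite lte_fin => /(cvgr_lt _ fct)/nbhs_ballP[e /= e0 eP].
  exists (r + e)%R; first by rewrite ltrDl.
  move=> s' /andP[rs' s'e]; rewrite lte_fin; apply: eP.
  by rewrite /ball/= ltr_norml; apply/andP; split; lra.
by move=> _; exists (r + 1)%R; [lra|move=> s' _; rewrite ltry].
Qed.

(** The ball of radius s around x lies in the ball of radius s' around y as soon as |x - y| < s' -
    s, so the integral does not drop, while the volume grows too little to lose the strict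
    inequality. Hence superlevel sets are open, and the witnessing balls may be given rational
    centres and radii. *)
Lemma HL_maximal_gt_open f a x : measurable_fun [set: E] f ->
  a%:E < HL_maximal_rV f x ->
  exists s e, [/\ (0 < s)%R, (0 < e)%R, (a * ball_volume s)%:E < \int[mu]_(z in eball x s) `|f z| &
   forall s' y, (s < s' < s + e)%R -> (enorm (x - y) < s' - s)%R ->
    (a * ball_volume s')%:E < \int[mu]_(z in eball y s') `|f z|].
Proof.
move=> mf /HL_maximal_gtP[r r0 ar].
have [s rs sP] := ball_volume_right_cont r0 ar.
exists r, (s - r)%R; split=> //; first by rewrite subr_gt0.
move=> s' y s'P xy; apply: lt_le_trans (sP s' _) _; first by lra.
apply: ge0_subset_integral => //; [exact: measurable_eball|exact: measurable_eball| | ].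
  by apply: measurableT_comp => //; exact: measurable_funTS.
by apply: eball_subset; lra.
Qed.

Lemma measurable_HL_maximal f : measurable_fun [set: E] f ->
  measurable_fun [set: E] (HL_maximal_rV f).
Proof.
move=> mf; apply: (measurability _ (ErealGenOInfty.measurableE R)).
move=> _ [_ [a ->] <-]; rewrite setTI.
apply: open_eball_measurable => x /=; rewrite in_itv/= andbT => ax.
have [s [e [s0 e0 _ P]]] := HL_maximal_gt_open mf ax.
exists (e / 2)%R; first by rewrite divr_gt0.
move=> y; rewrite eballE/= in_itv/= andbT => yx; apply/HL_maximal_gtP.
exists (s + e / 2)%R; first by lra.
by apply: P; [lra|rewrite enorm_subC; lra].
Qed.

Definition balls_union (s : seq (V * R)) : set E :=
  \bigcup_(b in [set` s]) eball b.1 b.2.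

Lemma measurable_balls_union s : measurable (balls_union s).
Proof.
rewrite /balls_union bigcup_seq.
by apply: bigsetU_measurable => b _; exact: measurable_eball.
Qed.

Lemma exists_largest_ball (s : seq (V * R)) : s != [::] ->
  exists2 b, b \in s & forall c, c \in s -> (c.2 <= b.2)%R.
Proof.
elim: s => // b s ih _; have [->|/ih[c cs cP]] := eqVneq s [::].
  by exists b; rewrite ?mem_head// => c; rewrite inE => /eqP->.
have [bc|/ltW cb] := leP b.2 c.2.
  exists c; first by rewrite inE cs orbT.
  by move=> d; rewrite inE => /predU1P[->//|/cP].
exists b; first by rewrite mem_head.
by move=> d; rewrite inE => /predU1P[->//|/cP /le_trans]; exact.
Qed.

(* The greedy Vitali selection, run directly on the measures: the balls meeting
   the largest one lie in its threefold dilation. *)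
Lemma vitali_weak_bound g a (s : seq (V * R)) :
  measurable_fun [set: E] g -> (forall x, 0 <= g x) -> (0 <= a)%R ->
  (forall b, b \in s -> (0 < b.2)%R /\
     (a * ball_volume b.2)%:E <= \int[mu]_(y in eball b.1 b.2) g y) ->
  a%:E * mu (balls_union s) <=
    (3 ^+ n.+1)%:E * \int[mu]_(y in balls_union s) g y.
Proof.
move=> mg g0 a0.
have [N] := ubnP (size s); elim: N s => // N ih s sN sP.
have [s0|/exists_largest_ball[b bs bmax]] := eqVneq s [::].
  rewrite /balls_union s0 set_nil bigcup_set0 measure0 mule0.
  by rewrite integral_set0 mule0.
have [b0 ab] := sP _ bs.
pose t := [seq c <- s | `[< eball c.1 c.2 `&` eball b.1 b.2 = set0 >]].
have tP c : c \in t -> (0 < c.2)%R /\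
     (a * ball_volume c.2)%:E <= \int[mu]_(y in eball c.1 c.2) g y.
  by rewrite mem_filter => /andP[_ /sP].
(* The largest ball contains its own centre, so it is not disjoint from itself; [t] is therefore
   strictly shorter than [s] and the induction applies. *)
have bt : b \notin t.
  rewrite mem_filter bs andbT; apply/negP => /asboolP; rewrite setIid => b00.
  have : eball b.1 b.2 b.1 by rewrite eballE/= subrr -(scale0r 0%R) enormZ normr0 mul0r.
  by rewrite b00.
have tN : (size t < N)%N.
  rewrite -ltnS (leq_trans _ sN)// ltnS size_filter.
  rewrite ltn_neqAle count_size andbT -all_count; apply/negP => /allP/(_ _ bs)h.
  by move: bt; rewrite mem_filter bs h.
have subU : balls_union s `<=` eball b.1 (3 * b.2) `|` balls_union t.
  move=> y [c cs cy]; have [cb|cb] := pselect (eball c.1 c.2 `&` eball b.1 b.2 = set0).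
    by right; exists c => //=; rewrite mem_filter cs andbT; exact/asboolP.
  left; have /set0P[z []] : eball c.1 c.2 `&` eball b.1 b.2 != set0 by exact/eqP.
  have := bmax _ cs; move: cy; rewrite !eballE/= => cy cb2 zc zb.
  have := enorm_triangle y c.1 b.1; have := enorm_triangle c.1 z b.1.
  by rewrite (enorm_subC c.1 z); lra.
have subU2 : eball b.1 b.2 `|` balls_union t `<=` balls_union s.
  move=> y [by_|[c]]; first by exists b.
  by rewrite /= mem_filter => /andP[_ cs] cy; exists c.
have mU := measurable_balls_union.
have mB := @measurable_eball R n.
apply: (@le_trans _ _ (a%:E * ((3 ^+ n.+1 * ball_volume b.2)%:E + mu (balls_union t)))).
  rewrite lee_wpmul2l ?lee_fin// -ball_volumeM -(mu_eballE b.1) ?mulr_gt0//.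
  apply: (le_trans _ (measureU2 _ (mB _ _) (mU _))).
  by apply: le_measure; rewrite ?inE//; exact: measurableU.
rewrite ge0_muleDr ?lee_fin ?measure_ge0//; last first.
  by rewrite mulr_ge0 ?exprn_ge0 ?ltW// ball_volume_gt0.
have U3 : (0 <= 3 ^+ n.+1 :> R)%R by rewrite exprn_ge0.
apply: (@le_trans _ _ ((3 ^+ n.+1)%:E * (\int[mu]_(y in eball b.1 b.2) g y +
    \int[mu]_(y in balls_union t) g y))).
  rewrite ge0_muleDr ?integral_ge0//; apply: leeD; last exact: ih.
  by rewrite -EFinM mulrCA EFinM lee_wpmul2l ?lee_fin.
(* The largest ball is disjoint from all balls of [t] by construction, so the two integrals add up
   to one over a subset of the full union. *)
rewrite lee_wpmul2l ?lee_fin// -ge0_integral_setU//.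
- apply: ge0_subset_integral => //; first exact: measurableU.
  exact: measurable_funTS.
- exact: measurable_funTS.
- rewrite disj_set2E; apply/eqP; rewrite /balls_union setI_bigcupr.
  apply: bigcup0 => c /=; rewrite mem_filter => /andP[/asboolP + _].
  by rewrite setIC.
Qed.

(** The covering bound concerns finite families. The balls with rational data and mean at least [a]
    are countably many; [s k] lists those with code below [k]. Their unions increase to a set
    containing the superlevel set, and continuity of the measure from below concludes. *)
Lemma HL_maximal_weak_type f a : measurable_fun [set: E] f -> (0 < a)%R ->
  a%:E * mu [set x | a%:E < HL_maximal_rV f x] <=
    (3 ^+ n.+1)%:E * \int[mu]_x `|f x|.
Proof.
move=> mf a0.
have mg : measurable_fun [set: E] (fun x => `|f x|) by exact: measurableT_comp.
pose T := ('rV[rat]_n.+1 * rat)%type.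
pose B (c : T) : V * R := (map_mx ratr c.1, ratr c.2).
pose good (c : T) := `[< (0 < (B c).2)%R /\
  (a * ball_volume (B c).2)%:E <= \int[mu]_(y in eball (B c).1 (B c).2) `|f y| >].
pose s k := [seq B c | c <- pmap (@unpickle T) (iota 0 k) & good c].
pose A k := balls_union (s k).
have mA k : measurable (A k) by exact: measurable_balls_union.
have ndA : nondecreasing_seq A.
  move=> k l kl; apply/subsetPset => y [b /=] /mapP[c]; rewrite mem_filter.
  move=> /andP[gc]; rewrite mem_pmap => /mapP[i]; rewrite mem_iota/= => ik ci -> cy.
  exists (B c) => //=; apply/mapP; exists c => //; rewrite mem_filter gc/=.
  rewrite mem_pmap; apply/mapP; exists i => //.
  by rewrite mem_iota/= (leq_trans _ kl).
have subA : [set x | a%:E < HL_maximal_rV f x] `<=` \bigcup_k A k.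
  move=> x /= /(HL_maximal_gt_open mf)[r [e [r0 e0 _ P]]].
  have re : (r < r + e)%R by lra.
  have [q] := rat_in_itvoo re; rewrite in_itv/= => /andP[rq qe].
  have qr : (0 < ratr q - r)%R by lra.
  have [c xc] := rat_dense x qr.
  exists (pickle (c, q)).+1 => //; exists (B (c, q)) => /=; last first.
    by rewrite eballE/=; lra.
  apply/mapP; exists (c, q) => //; rewrite mem_filter; apply/andP; split.
    by apply/asboolP; split => /=; [lra|apply/ltW/P => //; apply/andP; split; lra].
  rewrite mem_pmap; apply/mapP; exists (pickle (c, q)); last by rewrite pickleK.
  by rewrite mem_iota/=.
apply: (@le_trans _ _ (a%:E * mu (\bigcup_k A k))).
  rewrite lee_wpmul2l ?lee_fin ?(ltW a0)//.
  exact: le_lebesgue_measure_rV.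
rewrite -lee_pdivlMl//.
have cvA : mu (A k) @[k --> \oo] --> mu (\bigcup_k A k).
  exact: (nondecreasing_cvg_mu mA (bigcupT_measurable _ mA) ndA).
rewrite -(cvg_lim _ cvA)//; apply: lime_le; first by apply/cvg_ex; eexists; exact: cvA.
near=> k; rewrite lee_pdivlMl//.
apply: (le_trans (vitali_weak_bound mg _ (ltW a0) _)) => //.
  by move=> b /mapP[c]; rewrite mem_filter => /andP[/asboolP gc _] ->.
rewrite lee_wpmul2l ?lee_fin ?exprn_ge0//.
apply: ge0_subset_integral => //; exact: measurable_balls_union.
Unshelve. all: by end_near. Qed.

End maximal_function.

(** * Integrals above a level by geometric layers *)

Section superlevel_integral.
Context d {T : measurableType d} {R : realType}.
Variable mu : {measure set T -> \bar R}.
Local Open Scope ereal_scope.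

Lemma nneseries_geometric (c z : R) : (0 <= z < 1)%R ->
  \sum_(k <oo) (c * z ^+ k)%:E = (c / (1 - z))%:E.
Proof.
move=> /andP[z0 z1].
have h : series (geometric c z) @ \oo --> (c / (1 - z))%R.
  by apply: cvg_geometric_series; rewrite ger0_norm.
have /cvg_lim : (EFin \o series (geometric c z)) @ \oo --> (c / (1 - z))%:E.
  by apply: cvg_EFin => //; near=> x.
move=> <-//; apply: congr_lim; apply/funext => k /=.
by rewrite /series/= sumEFin.
Unshelve. all: by end_near. Qed.

Lemma nneseries_ge_term (u : nat -> \bar R) (N : nat) :
  (forall k, 0 <= u k) -> u N <= \sum_(k <oo) u k.
Proof.
move=> u0; apply: le_trans (nneseries_lim_ge N.+1 _) => //.
by rewrite big_nat_recr//= leeDr// sume_ge0.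
Qed.

Lemma exists_exprn_ge (b A x : R) : (1 < b)%R -> (0 < A)%R ->
  exists N, (x <= b ^+ N * A)%R.
Proof.
move=> b1 A0; have bern N : (1 + N%:R * (b - 1) <= b ^+ N)%R.
  elim: N => [|N ih]; first by rewrite mul0r addr0 expr0.
  have b0 : (0 <= b)%R by lra.
  rewrite exprS -natr1; apply: le_trans (ler_wpM2l b0 ih).
  have := mulr_ge0 (ler0n R N) (sqr_ge0 (b - 1)%R).
  by rewrite !expr2; lra.
have c0 : (0 < A * (b - 1))%R by rewrite mulr_gt0// subr_gt0.
have [N xN] : exists N : nat, (x / (A * (b - 1)) < N%:R)%R.
  by exists (Num.truncn (x / (A * (b - 1)))).+1; rewrite truncnS_gt.
exists N; move: xN; rewrite ltr_pdivrMr// => /ltW /le_trans; apply.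
rewrite mulrCA mulrC ler_pM2r//.
by apply: le_trans (bern N); rewrite lerDr.
Qed.

(* On the layer b^k A < |g| <= b^(k+1) A the function is at most b^(k+1) A, and
   the resulting series has ratio b / 2. *)
Lemma integral_superlevel_le (g : T -> \bar R) (b A t : R) :
  measurable_fun [set: T] g -> (1 < b < 2)%R -> (0 < A)%R -> (0 <= t)%R ->
  (forall k : nat, mu [set x | (b ^+ k * A)%:E < `|g x|] <= (t / 2 ^+ k)%:E) ->
  \int[mu]_(x in [set x | A%:E < `|g x|]) `|g x| <= (2 * b / (2 - b) * A * t)%:E.
Proof.
move=> mg /andP[b1 b2] A0 t0 h.
have b0 : (0 < b)%R by lra.
pose S k := [set x | (b ^+ k * A)%:E < `|g x|].
have mag : measurable_fun [set: T] (fun x => `|g x|) by exact: measurableT_comp.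
have mS k : measurable (S k).
  by rewrite -[S k]setTI; exact: emeasurable_fun_o_infty.
have c0 k : (0 <= b ^+ k.+1 * A)%R by rewrite mulr_ge0 ?exprn_ge0 ?ltW.
pose u k x := (b ^+ k.+1 * A)%:E * (\1_(S k) x)%:E.
have u0 k x : 0 <= u k x by rewrite mule_ge0 ?lee_fin.
have mu_ k D : measurable_fun D (u k).
  by apply: measurable_funeM; exact/measurable_EFinP/measurable_indic.
have S0 : [set x | A%:E < `|g x|] = S 0%N by rewrite /S expr0 mul1r.
have ptw x : S 0%N x -> `|g x| <= \sum_(k <oo) u k x.
  move=> S0x.
  (* Testing against real [m] also covers infinite values of g. If N is the least exponent with m <=
     b^N A, a single term suffices: for N = k+1 minimality puts x in [S k], whose term is b^(k+1) A,
     and for N = 0 the term of index 0 is large enough. *)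
  have low (m : R) : m%:E <= `|g x| -> m%:E <= \sum_(k <oo) u k x.
    move=> mgx; have hN := exists_exprn_ge m b1 A0.
    case: (ex_minnP hN) => -[|k] mk kmin.
      apply: le_trans (nneseries_ge_term 0%N (u0^~ x)).
      rewrite /u indicE mem_set// mule1 lee_fin (le_trans mk)// ler_pM2r//.
      by rewrite expr0 expr1 ltW.
    apply: le_trans (nneseries_ge_term k (u0^~ x)).
    rewrite /u indicE mem_set ?mule1 ?lee_fin//=.
    apply: lt_le_trans mgx; rewrite lte_fin ltNge; apply/negP => /kmin.
    by rewrite ltnn.
  move: low; case: `|g x| => [r low|low|low]; [exact: low| |exact: leNye].
  rewrite leye_eq; apply/eqP/eq_infty => m; apply: low; exact: leey.
rewrite S0.
apply: (@le_trans _ _ (\int[mu]_(x in S 0%N) \sum_(k <oo) u k x)).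
  apply: ge0_le_integral => //.
  - exact: measurable_funTS.
  - exact: ge0_emeasurable_sum.
rewrite integral_nneseries//.
apply: (@le_trans _ _ (\sum_(k <oo) (b * A * t * (b / 2) ^+ k)%:E)).
  apply: lee_nneseries => [k _ _|k _]; first exact: integral_ge0.
  have m1 : measurable_fun (S 0%N) (fun x => (\1_(S k) x)%:E : \bar R).
    exact/measurable_EFinP/measurable_indic.
  rewrite /u ge0_integralZl ?lee_fin//.
  rewrite integral_indic//.
  apply: (@le_trans _ _ ((b ^+ k.+1 * A)%:E * (t / 2 ^+ k)%:E)).
    rewrite lee_wpmul2l ?lee_fin//; apply: le_trans (h k).
    apply: le_measure; rewrite ?inE; [exact: measurableI|exact: mS|].
    exact: subIsetl.
  rewrite -EFinM lee_fin expr_div_n exprS le_eqVlt; apply/orP; left; apply/eqP; ring.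
(* The sum is b A t / (1 - b/2), which is the stated constant times A t. *)
rewrite nneseries_geometric; last by apply/andP; split; lra.
rewrite lee_fin le_eqVlt; apply/orP; left; apply/eqP; field.
by rewrite gt_eqF//; lra.
Qed.

End superlevel_integral.

(** * Dilation invariance of dt/t *)

Section multiplicative_haar.
Context {R : realType}.
Local Notation leb := (@lebesgue_measure R).
Local Open Scope ereal_scope.

(** The left side is c times a pushforward of Lebesgue measure; it agrees with Lebesgue measure on
    half-open intervals, and uniqueness gives all measurable sets. *)
Lemma lebesgue_measure_scale (c : R) (c0 : (0 < c)%R) (A : set R) : measurable A ->
  c%:E * leb [set t | A (c * t)%R] = leb A.
Proof.
move=> mA.
pose phi : measurableTypeR R -> measurableTypeR R := fun t => (c * t)%R.
have mphi : measurable_fun [set: measurableTypeR R] phi by exact: mulrl_measurable.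
pose m := mscale (NngNum (ltW c0)) (pushforward leb phi).
suff : forall A, measurable A -> leb A = m mphi A by move=> /(_ A mA) ->.
apply: lebesgue_measure_unique => _ [[a b] _ <-].
rewrite -[RHS]/(c%:E * leb (phi @^-1` `]a, b])).
have -> : phi @^-1` `]a, b] = `](a / c)%R, (b / c)%R]%classic.
  apply/seteqP; split => t /=; rewrite !in_itv/= /phi.
    by rewrite ltr_pdivrMr// ler_pdivlMr// mulrC.
  by rewrite ltr_pdivrMr// ler_pdivlMr// mulrC.
rewrite !lebesgue_measure_itv/= !lte_fin ltr_pM2r ?invr_gt0//.
case: ifPn => _; last by rewrite mule0.
rewrite -!EFinD -EFinM; congr EFin; field.
by rewrite gt_eqF.
Qed.

Lemma integral_scale_dt_over_t (c : R) (F : R -> \bar R) : (0 < c)%R ->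
  measurable_fun (`]0%R, +oo[%classic : set R) F -> (forall t, 0 <= F t) ->
  \int[leb]_(t in `]0%R, +oo[) (F (c * t)%R * (t^-1)%:E) =
  \int[leb]_(t in `]0%R, +oo[) (F t * (t^-1)%:E).
Proof.
move=> c0 mF F0.
pose phi : measurableTypeR R -> measurableTypeR R := fun t => (c * t)%R.
have mphi : measurable_fun [set: measurableTypeR R] phi by exact: mulrl_measurable.
pose m := mscale (NngNum (ltW c0)) (pushforward leb phi).
have minv : measurable_fun (`]0%R, +oo[%classic : set R) (fun t : R => t^-1)%R.
  apply: (eq_measurable_fun (fun t : R => t `^ (-1))%R).
    move=> t; rewrite inE/= in_itv/= andbT => t0.
    by rewrite powR_inv1// ltW.
  exact: measurable_funTS (measurable_powR (-1)).
have mG : measurable_fun (`]0%R, +oo[%classic : set R) (fun t => F t * (t^-1)%:E).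
  by apply: emeasurable_funM => //; exact/measurable_EFinP.
have G0 t : `]0%R, +oo[%classic t -> 0 <= F t * (t^-1)%:E.
  rewrite /= in_itv/= andbT => t0.
  by apply: mule_ge0 => //; rewrite lee_fin invr_ge0 ltW.
transitivity (\int[m mphi]_(t in `]0%R, +oo[) (F t * (t^-1)%:E)); last first.
  apply: eq_measure_integral => A mA _.
  exact: (lebesgue_measure_scale c0 mA).
transitivity (c%:E * \int[pushforward leb phi]_(t in `]0%R, +oo[) (F t * (t^-1)%:E)); last first.
  by apply/esym; apply: ge0_integral_mscale.
have phiE : phi @^-1` `]0%R, +oo[ = `]0%R, +oo[%classic.
  by apply/seteqP; split => t /=; rewrite !in_itv/= !andbT /phi pmulr_rgt0.
transitivity (c%:E * \int[leb]_(t in phi @^-1` `]0%R, +oo[)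
    (F (c * t)%R * ((c * t)^-1)%:E)); last first.
  congr *%E; apply/esym; apply: (ge0_integral_pushforward mphi) => //.
  by move=> t; rewrite inE; exact: G0.
have mGc : measurable_fun (`]0%R, +oo[%classic : set R)
    (fun t => F (c * t)%R * ((c * t)^-1)%:E).
  have mc : measurable_fun (`]0%R, +oo[%classic : set R) ( *%R c).
    exact: mulrl_measurable.
  apply: (measurable_comp _ _ mG mc) => //.
  by move=> _ [t /= + <-]; rewrite !in_itv/= !andbT => t0; rewrite mulr_gt0.
have G0c t : `]0%R, +oo[%classic t -> 0 <= F (c * t)%R * ((c * t)^-1)%:E.
  rewrite /= in_itv/= andbT => t0.
  by apply: mule_ge0 => //; rewrite lee_fin invr_ge0 ltW// mulr_gt0.
rewrite phiE -ge0_integralZl//.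
  apply: eq_integral => t; rewrite inE/= in_itv/= andbT => t0.
  rewrite muleCA -EFinM; congr (_ * _%:E); field.
  by rewrite !gt_eqF.
by rewrite lee_fin ltW.
Qed.

End multiplicative_haar.

Section extended_reals.
Context {R : realType}.
Local Open Scope ereal_scope.

(** Reduces estimates between extended reals to estimates with real constants; an infinite [y]
    leaves nothing to prove. *)
Lemma lee_real_upper_bounds (x y : \bar R) : 0 <= y ->
  (forall r : R, y < r%:E -> x <= r%:E) -> x <= y.
Proof.
case: y => [y| |//] _ h; last exact: leey.
apply/lee_addgt0Pr => e e0; rewrite -EFinD; apply: h.
by rewrite lte_fin ltrDl.
Qed.

Lemma le_poweR (r : R) (x y : \bar R) : (0 <= r)%R -> 0 <= x -> x <= y ->
  x `^ r <= y `^ r.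
Proof.
move=> r0 x0 xy; apply: gt0_ler_poweR => //; rewrite in_itv/= leey andbT//.
exact: le_trans xy.
Qed.

Lemma poweRK (x : \bar R) (r : R) : r != 0%R -> 0 <= x -> (x `^ r) `^ r^-1 = x.
Proof. by move=> r0 x0; rewrite -poweRrM mulfV// poweRe1. Qed.

End extended_reals.

(** * Rearrangements and the Lorentz integral *)

Section rearrangement_theory.
Context {R : realType} {n : nat}.
Local Notation E := (lebesgue_rV R n).
Local Notation mu := (@lebesgue_measure_rV R n).
Implicit Types (f g : E -> \bar R) (t m : R).
Local Open Scope ereal_scope.

Lemma rearrangement_ge0 f t : 0 <= rearrangement f t.
Proof.
by apply: le_ereal_inf_tmp => _ [m [m0 _] <-]; rewrite lee_fin ltW.
Qed.

Lemma rearrangement_le f t m : (0 < m)%R ->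
  mu [set x | m%:E < `|f x|] <= t%:E -> rearrangement f t <= m%:E.
Proof. by move=> m0 h; apply: ereal_inf_lbound; exists m. Qed.

Lemma rearrangement_lt f t m : rearrangement f t < m%:E ->
  mu [set x | m%:E < `|f x|] <= t%:E.
Proof.
move=> /ereal_inf_lt[_ [m' [m'0 h] <-]]; rewrite lte_fin => m'm.
apply: le_trans h; apply: le_lebesgue_measure_rV => x /=.
by apply: lt_trans; rewrite lte_fin.
Qed.

Lemma le_rearrangement f g t s :
  (forall m, (0 < m)%R -> mu [set x | m%:E < `|g x|] <= s%:E ->
     mu [set x | m%:E < `|f x|] <= t%:E) ->
  rearrangement f t <= rearrangement g s.
Proof.
move=> h; apply: le_ereal_inf_tmp => _ [m [m0 gm] <-].
by apply: rearrangement_le => //; exact: h.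
Qed.

Lemma rearrangement_nonincreasing f t s : (t <= s)%R ->
  rearrangement f s <= rearrangement f t.
Proof. by move=> ts; apply: le_rearrangement => m _ /le_trans; apply; rewrite lee_fin. Qed.

(** By monotonicity the superlevel sets of the rearrangement are intervals. *)
Lemma measurable_rearrangement f (D : set R) : measurable D ->
  measurable_fun D (rearrangement f).
Proof.
move=> mD; apply: (measurability _ (ErealGenOInfty.measurableE R)).
move=> _ [_ [a ->] <-]; apply: measurableI => //.
apply: is_interval_measurable => s t /=; rewrite !in_itv/= !andbT.
move=> as_ at_ u /andP[_ ut]; rewrite in_itv/= andbT.
exact: lt_le_trans (rearrangement_nonincreasing _ ut).
Qed.

(** The factor t^-1 is left out so that dilations can act on this function alone while dt/t stays
    fixed. *)
Definition lorentz_density (p q : R) f t : \bar R :=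
  ((t `^ p^-1)%:E * rearrangement f t) `^ q.

Definition lorentz_integral (p q : R) f : \bar R :=
  \int[@lebesgue_measure R]_(t in `]0%R, +oo[)
     (lorentz_density p q f t * (t^-1)%:E).

Lemma lorentz_density_ge0 p q f t : 0 <= lorentz_density p q f t.
Proof. exact: poweR_ge0. Qed.

Lemma lorentz_integral_ge0 p q f : 0 <= lorentz_integral p q f.
Proof.
apply: integral_ge0 => t /=; rewrite in_itv/= andbT => t0.
by rewrite mule_ge0 ?lorentz_density_ge0// lee_fin invr_ge0 ltW.
Qed.

Lemma measurable_lorentz_density p q f (D : set R) : measurable D ->
  measurable_fun D (lorentz_density p q f).
Proof.
move=> mD; apply: (measurableT_comp (measurable_poweR q)).
apply: emeasurable_funM; last exact: measurable_rearrangement.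
apply/measurable_EFinP; apply: measurable_funTS; exact: measurable_powR.
Qed.

Lemma measurable_dt_over_t (F : R -> \bar R) :
  measurable_fun (`]0%R, +oo[%classic : set R) F ->
  measurable_fun (`]0%R, +oo[%classic : set R) (fun t => F t * (t^-1)%:E).
Proof.
move=> mF; apply: emeasurable_funM => //; apply/measurable_EFinP.
apply: (eq_measurable_fun (fun t : R => t `^ (-1))%R).
  move=> t; rewrite inE/= in_itv/= andbT => t0.
  by rewrite powR_inv1// ltW.
exact: measurable_funTS (measurable_powR (-1)).
Qed.

Lemma le_integral_dt_over_t (F G : R -> \bar R) :
  measurable_fun (`]0%R, +oo[%classic : set R) F ->
  measurable_fun (`]0%R, +oo[%classic : set R) G ->
  (forall t, 0 <= F t) -> (forall t, (0 < t)%R -> F t <= G t) ->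
  \int[@lebesgue_measure R]_(t in `]0%R, +oo[) (F t * (t^-1)%:E) <=
  \int[@lebesgue_measure R]_(t in `]0%R, +oo[) (G t * (t^-1)%:E).
Proof.
move=> mF mG F0 FG; apply: ge0_le_integral => //.
- move=> t /=; rewrite in_itv/= andbT => t0.
  by rewrite mule_ge0// lee_fin invr_ge0 ltW.
- exact: measurable_dt_over_t.
- exact: measurable_dt_over_t.
- move=> t /=; rewrite in_itv/= andbT => t0.
  by rewrite lee_wpmul2r ?FG// lee_fin invr_ge0 ltW.
Qed.

Lemma weighted_poweR_scale (p q c t : R) (x : \bar R) :
  (0 < c)%R -> (0 < t)%R -> 0 <= x ->
  (((c * t) `^ p^-1)%:E * x) `^ q = (c `^ (q / p))%:E * ((t `^ p^-1)%:E * x) `^ q.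
Proof.
move=> c0 t0 x0; rewrite powRM ?ltW// EFinM -muleA [LHS]poweRM ?lee_fin ?powR_ge0//.
  by rewrite poweR_EFin -powRrM [(p^-1 * q)%R]mulrC.
by rewrite mule_ge0// lee_fin powR_ge0.
Qed.

Lemma lorentz_normE p q f : lorentz_norm p q f = lorentz_integral p q f `^ q^-1.
Proof. by []. Qed.

(* The mass of the integral on [t/2, t], where the rearrangement is at least its
   value at t. *)
Lemma lorentz_density_le_integral p q f t : (0 < p)%R -> (0 < q)%R -> (0 < t)%R ->
  lorentz_density p q f t <= (2 `^ (q / p) * 2)%:E * lorentz_integral p q f.
Proof.
move=> p0 q0 t0; have p20 : (0 < 2 `^ (q / p) :> R)%R by rewrite powR_gt0.
have c0 : (0 < 2 `^ (q / p) * 2 :> R)%R by rewrite mulr_gt0.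
rewrite -lee_pdivrMl//.
pose D : set R := `](t / 2)%R, t]%classic.
have mD : measurable D by exact: measurable_itv.
have DI : D `<=` `]0%R, +oo[%classic.
  by move=> s; rewrite /D/= !in_itv/= andbT => /andP[ts _]; rewrite (lt_trans _ ts)// divr_gt0.
have mI := measurable_dt_over_t (measurable_lorentz_density p q f (measurable_itv `]0%R, +oo[)).
apply: (@le_trans _ _ (\int[@lebesgue_measure R]_(s in D)
    (lorentz_density p q f s * (s^-1)%:E))); last first.
  apply: ge0_subset_integral => //.
  move=> s /=; rewrite in_itv/= andbT => s0.
  by rewrite mule_ge0 ?lorentz_density_ge0// lee_fin invr_ge0 ltW.
(* On [D] the weight s^(1/p) loses at most the factor 2^(1/p) against t^(1/p), and s^-1 is at least
   t^-1. The length t/2 of [D] accounts for the remaining factor 2. *)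
apply: (@le_trans _ _ (\int[@lebesgue_measure R]_(s in D)
    ((2 `^ (q / p))^-1%:E * lorentz_density p q f t * (t^-1)%:E))).
  rewrite integral_cst//= lebesgue_measure_itv/= lte_fin.
  rewrite ifT; last lra.
  rewrite -EFinB -muleA -EFinM -muleAC -EFinM lee_wpmul2r ?lorentz_density_ge0//.
  rewrite lee_fin le_eqVlt; apply/orP; left; apply/eqP; field.
  by rewrite !gt_eqF.
apply: ge0_le_integral => //.
- move=> s _; rewrite !mule_ge0 ?lorentz_density_ge0 ?lee_fin ?invr_ge0 ?(ltW t0) ?(ltW p20)//.
- exact: measurable_funS mI.
- move=> s Ds; have := DI _ Ds; rewrite /= in_itv/= andbT => s0.
  move: Ds; rewrite /D/= in_itv/= => /andP[ts st].
  apply: lee_pmul.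
  + by rewrite mule_ge0 ?lorentz_density_ge0// lee_fin invr_ge0 ltW.
  + by rewrite lee_fin invr_ge0 ltW.
  + rewrite lee_pdivrMl// /lorentz_density -weighted_poweR_scale ?rearrangement_ge0//.
    apply: le_poweR; first exact: ltW.
      by rewrite mule_ge0 ?rearrangement_ge0// lee_fin powR_ge0.
    apply: lee_pmul; rewrite ?rearrangement_ge0 ?lee_fin ?powR_ge0//.
      apply: ge0_ler_powR; rewrite ?nnegrE; lra || by rewrite ?invr_ge0 ltW.
    exact: rearrangement_nonincreasing.
  + by rewrite lee_fin lef_pV2.
Qed.

End rearrangement_theory.

Lemma exists_power_base {R : realType} (p : R) : 1 < p ->
  exists b : R, 2 `^ p^-1 < b < 2.
Proof.
move=> p1; have p0 : 0 < p by lra.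
have h : 2 `^ p^-1 < 2 :> R.
  rewrite -[X in _ < X](@powRr1 R 2)//.
  rewrite /powR gt_eqF// ltr_expR ltr_pM2r ?ln_gt0 ?ltr1n//.
  by rewrite invf_lt1.
by exists ((2 `^ p^-1 + 2) / 2); apply/andP; split; lra.
Qed.

Lemma exprn_powR {R : realType} (x y : R) k : 0 <= x ->
  (x ^+ k) `^ y = (x `^ y) ^+ k.
Proof. by move=> x0; rewrite -powR_mulrn// powRAC powR_mulrn// powR_ge0. Qed.

Lemma invr_powR {R : realType} (x y : R) : 0 <= x -> (x^-1) `^ y = (x `^ y)^-1.
Proof. by move=> x0; rewrite -powR_inv1// powRAC powR_inv1// powR_ge0. Qed.

(** * Truncation at a level *)

Section truncation.
Context {d} {T : measurableType d} {R : realType}.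
Variable mu : {measure set T -> \bar R}.
Local Open Scope ereal_scope.
Implicit Type g : T -> \bar R.

Lemma measurable_superlevel g (A : R) : measurable_fun [set: T] g ->
  measurable [set x | A%:E < `|g x|].
Proof.
move=> mg; rewrite -[X in measurable X]setTI.
by apply: emeasurable_fun_o_infty => //; exact: measurableT_comp.
Qed.

Lemma measurable_funT_restrict g (D B : set T) : measurable D ->
  measurable_fun [set: T] g -> measurable_fun B (g \_ D).
Proof.
move=> mD mg; apply: (@measurable_funTS _ _ _ _ B); apply/measurable_restrict => //.
by rewrite setTI; exact: measurable_funTS.
Qed.

Lemma integral_le_truncation g (B : set T) (A : R) : measurable B ->
  measurable_fun [set: T] g -> (0 <= A)%R ->
  \int[mu]_(x in B) `|g x| <=
  \int[mu]_(x in B) `|(g \_ [set y | A%:E < `|g y|]) x| + A%:E * mu B.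
Proof.
move=> mB mg A0; set D := [set y | _].
have mD : measurable D by exact: measurable_superlevel.
have mag : measurable_fun B (fun x => `|g x|).
  by apply: measurableT_comp => //; exact: measurable_funTS.
have mg1 : measurable_fun B (fun y => `|(g \_ D) y|).
  by apply: measurableT_comp => //; exact: measurable_funT_restrict.
rewrite -(integral_cst mu mB) -ge0_integralD//.
apply: ge0_le_integral => //; first exact: emeasurable_funD.
move=> y _; rewrite patchE; case: ifPn => yD /=.
  by rewrite leeDl// lee_fin.
by rewrite normr0 add0e leNgt; apply/negP => Agy; move: yD; rewrite notin_setE; apply.
Qed.

Lemma integral_abse_restrict g (D : set T) :
  \int[mu]_x `|(g \_ D) x| = \int[mu]_(x in D) `|g x|.
Proof.
rewrite [RHS]integral_mkcond; apply: eq_integral => x _.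
by rewrite !patchE; case: ifP => //; rewrite abse0.
Qed.

Lemma integral_le_superlevel g (B : set T) (A : R) : measurable B ->
  measurable_fun [set: T] g -> (0 <= A)%R ->
  \int[mu]_(x in B) `|g x| <=
  \int[mu]_(x in [set y | A%:E < `|g y|]) `|g x| + A%:E * mu B.
Proof.
move=> mB mg A0; apply: le_trans (integral_le_truncation mB mg A0) _.
apply: leeD2r; rewrite -[leRHS]integral_abse_restrict; apply: ge0_subset_integral => //.
apply: measurableT_comp => //.
exact: (measurable_funT_restrict (measurable_superlevel A mg) mg).
Qed.

End truncation.

(** * Boundedness of the maximal operator on L_(p,q) *)

Section lorentz_maximal.
Context {R : realType} {n : nat}.
Local Notation V := 'rV[R]_n.+1.
Local Notation E := (lebesgue_rV R n).
Local Notation mu := (@lebesgue_measure_rV R n).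
Implicit Types (f g : E -> \bar R).
Variables (p q b : R).
Hypotheses (p_gt1 : 1 < p) (q_gt0 : 0 < q) (hb : 2 `^ p^-1 < b < 2).
Hypothesis unit_ball_gt0 : (0 < fine (mu (eball (0 : V) 1)))%R.
Local Open Scope ereal_scope.

Let p_gt0 : (0 < p)%R. Proof. exact: lt_trans ltr01 p_gt1. Qed.

Let r2_gt0 : (0 < 2 `^ p^-1 :> R)%R. Proof. by rewrite powR_gt0. Qed.

Let r2_ge1 : (1 <= 2 `^ p^-1 :> R)%R.
Proof. by rewrite -[leLHS](powRr0 2); apply: ler_powR; rewrite ?ler1n// invr_ge0 ltW. Qed.

Let b_gt1 : (1 < b < 2)%R.
Proof. by have /andP[h1 h2] := hb; rewrite h2 (le_lt_trans r2_ge1). Qed.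

Let b_gt0 : (0 < b)%R. Proof. by have /andP[/(lt_trans ltr01)] := b_gt1. Qed.

Let superlevel_const : R := (2 * b / (2 - b))%R.

Let superlevel_const_gt0 : (0 < superlevel_const)%R.
Proof. by have /andP[_ b2] := b_gt1; rewrite divr_gt0 ?mulr_gt0// subr_gt0. Qed.

Let dilation : R := (3 ^+ n.+1 * superlevel_const)%R.

Let dilation_gt0 : (0 < dilation)%R.
Proof. by rewrite mulr_gt0// exprn_gt0. Qed.

(** The part of g not above A adds at most A to any mean, so a mean exceeding 2A leaves more than A
    for the part above. *)
Lemma HL_maximal_superlevel g (A : R) : measurable_fun [set: E] g -> (0 < A)%R ->
  [set x | (2 * A)%:E < HL_maximal_rV g x] `<=`
  [set x | A%:E < HL_maximal_rV (g \_ [set y | A%:E < `|g y|]) x].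
Proof.
move=> mg A0 x /= /(HL_maximal_gtP unit_ball_gt0)[r r0 h].
apply/(HL_maximal_gtP unit_ball_gt0); exists r => //.
rewrite ltNge; apply/negP => h1; move: h; apply/negP; rewrite -leNgt.
have h2 : \int[mu]_(y in eball x r) `|g y| <=
    \int[mu]_(y in eball x r) `|(g \_ [set y | A%:E < `|g y|]) y| +
    A%:E * mu (eball x r).
  exact: (integral_le_truncation _ (measurable_eball x r) mg (ltW A0)).
apply: (le_trans h2).
by rewrite mu_eballE// mulrDl mul1r mulrDl EFinD -EFinM leeD2r.
Qed.

(** The weak type bound divides by A an integral which is at most [superlevel_const] times A t. The
    level cancels, and what remains is t times [dilation], the product of the two constants. *)
Lemma rearrangement_HL_le g (A t : R) : measurable_fun [set: E] g ->
  (0 < A)%R -> (0 < t)%R ->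
  (forall k : nat, mu [set x | (b ^+ k * A)%:E < `|g x|] <= (t / 2 ^+ k)%:E) ->
  rearrangement (HL_maximal_rV g) (dilation * t) <= (2 * A)%:E.
Proof.
move=> mg A0 t0 h; apply: rearrangement_le; first by rewrite mulr_gt0.
set D := [set y | A%:E < `|g y|].
have mg1 : measurable_fun [set: E] (g \_ D).
  exact: (measurable_funT_restrict (measurable_superlevel A mg) mg).
apply: (@le_trans _ _ (mu [set x | A%:E < HL_maximal_rV (g \_ D) x])).
  apply: le_lebesgue_measure_rV => x /=.
  rewrite gee0_abs ?HL_maximal_ge0// => h2.
  exact: (HL_maximal_superlevel mg A0 h2).
have := HL_maximal_weak_type unit_ball_gt0 mg1 A0.
rewrite -lee_pdivlMl// => /le_trans; apply.
rewrite lee_pdivrMl//.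
rewrite integral_abse_restrict.
have := integral_superlevel_le mg b_gt1 A0 (ltW t0) h.
move=> h3; apply: (@le_trans _ _ ((3 ^+ n.+1)%:E * (superlevel_const * A * t)%:E)).
  by rewrite lee_wpmul2l// lee_fin exprn_ge0.
rewrite -!EFinM lee_fin /dilation le_eqVlt; apply/orP; left; apply/eqP; ring.
Qed.

Let ratio : R := ((2 `^ p^-1 / b) `^ q)%R.

Let ratio_itv : (0 <= ratio < 1)%R.
Proof.
rewrite powR_ge0/= -[ltRHS](_ : 1 `^ q = 1)%R ;last by rewrite powR1.
apply: gt0_ltr_powR; rewrite ?nnegrE//.
  by rewrite divr_ge0 ?ltW.
by rewrite ltr_pdivrMr// mul1r; have /andP[] := hb.
Qed.

Let dilation_const : R := ((dilation `^ p^-1 * 2) `^ q)%R.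

Let dilation_const_gt0 : (0 < dilation_const)%R.
Proof. by rewrite powR_gt0// mulr_gt0// powR_gt0. Qed.

(** The supremum over k of b^-k times the rearrangement at 2^-k t is replaced, after taking the
    power q, by a series that can be integrated term by term. *)
Lemma lorentz_density_HL_le g (t : R) : measurable_fun [set: E] g -> (0 < t)%R ->
  lorentz_density p q (HL_maximal_rV g) (dilation * t) <=
  dilation_const%:E *
    \sum_(k <oo) (ratio ^+ k)%:E * lorentz_density p q g ((2 ^+ k)^-1 * t).
Proof.
move=> mg t0; set S := \sum_(k <oo) _.
have u0 k : 0 <= (ratio ^+ k)%:E * lorentz_density p q g ((2 ^+ k)^-1 * t).
  by rewrite mule_ge0 ?lorentz_density_ge0// lee_fin exprn_ge0//; have /andP[] := ratio_itv.
have S0 : 0 <= S by exact: nneseries_ge0.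
rewrite -lee_pdivrMl//; apply: lee_real_upper_bounds => // s Ss.
have s0 : (0 < s)%R by rewrite -lte_fin (le_lt_trans S0).
rewrite lee_pdivrMl//.
pose a := (s `^ q^-1)%R.
have aq : (a `^ q = s)%R by rewrite -powRrM mulVf ?gt_eqF// powRr1// ltW.
have a0 : (0 < a)%R by rewrite powR_gt0.
(* Chosen so that (t^(1/p) A)^q = s, a real number above the whole series. *)
pose A := (a / t `^ p^-1)%R.
have tp0 : (0 < t `^ p^-1)%R by rewrite powR_gt0.
have A0 : (0 < A)%R by rewrite divr_gt0.
(* Otherwise the term of index k alone would reach s: [ratio ^+ k] cancels exactly the powers of
   2^(1/p) and of b produced by the dilation and by the level b^k A. *)
have step k : rearrangement g ((2 ^+ k)^-1 * t) < (b ^+ k * A)%:E.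
  rewrite ltNge; apply/negP => h.
  have := lt_le_trans Ss (le_refl _); apply/negP; rewrite -leNgt.
  apply: le_trans (nneseries_ge_term k u0).
  have bA0 : 0 <= (((2 ^+ k)^-1 * t) `^ p^-1)%:E * (b ^+ k * A)%:E.
    by rewrite mule_ge0// lee_fin ?powR_ge0// mulr_ge0 ?exprn_ge0// ltW.
  apply: (@le_trans _ _ ((ratio ^+ k)%:E *
      ((((2 ^+ k)^-1 * t) `^ p^-1)%:E * (b ^+ k * A)%:E) `^ q)); last first.
    rewrite lee_wpmul2l ?lee_fin ?exprn_ge0//; first by have /andP[] := ratio_itv.
    by apply: le_poweR => //; [exact: ltW|rewrite lee_wpmul2l// lee_fin powR_ge0].
  have -> : (((2 ^+ k)^-1 * t) `^ p^-1 = (2 `^ p^-1) ^- k * t `^ p^-1)%R.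
    rewrite powRM ?invr_ge0 ?exprn_ge0 ?(ltW t0)//; congr *%R.
    by rewrite invr_powR ?exprn_ge0// exprn_powR.
  rewrite -(EFinM (2 `^ p^-1 ^- k * t `^ p^-1)) poweR_EFin -(EFinM (ratio ^+ k)) lee_fin.
  have rb0 : (0 <= 2 `^ p^-1 / b)%R by rewrite divr_ge0// ltW.
  rewrite /ratio -exprn_powR//.
  have w0 : (0 <= 2 `^ p^-1 ^- k * t `^ p^-1 * (b ^+ k * A))%R.
    by apply: mulr_ge0; [rewrite mulr_ge0// ltW// invr_gt0 exprn_gt0|
      rewrite mulr_ge0// ?(ltW A0)// exprn_ge0// ltW].
  rewrite -powRM ?exprn_ge0//.
  rewrite [X in (_ <= X `^ q)%R](_ : _ = a) ?aq// /A expr_div_n.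
  field; rewrite !expf_neq0/= ?andbT; [|exact: lt0r_neq0..].
  exact: lt0r_neq0.
have h k : mu [set x | (b ^+ k * A)%:E < `|g x|] <= (t / 2 ^+ k)%:E.
  by rewrite [(t / _)%R]mulrC; exact: rearrangement_lt (step k).
have := rearrangement_HL_le mg A0 t0 h => h2.
apply: (@le_trans _ _ ((((dilation * t) `^ p^-1)%:E * (2 * A)%:E) `^ q)).
  apply: le_poweR; first exact: ltW.
    by rewrite mule_ge0 ?rearrangement_ge0// lee_fin powR_ge0.
  by rewrite lee_wpmul2l// lee_fin powR_ge0.
rewrite -(EFinM ((dilation * t) `^ p^-1)) poweR_EFin -(EFinM dilation_const) lee_fin.
have d0 : (0 <= dilation `^ p^-1 * 2)%R by rewrite mulr_ge0// powR_ge0.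
rewrite /dilation_const -aq -powRM ?(ltW a0)//.
rewrite powRM ?(ltW dilation_gt0) ?(ltW t0)//.
rewrite le_eqVlt; apply/orP; left; apply/eqP; congr (_ `^ q)%R.
by rewrite /A; field; rewrite gt_eqF.
Qed.

Let maximal_const : R := (dilation_const / (1 - ratio))%R.

(** Invariance of dt/t removes both the dilation on the left and the factors 2^-k on the right, so
    the term of index k integrates to [ratio ^+ k] times the Lorentz integral of g. *)
Lemma lorentz_integral_HL_le g : measurable_fun [set: E] g ->
  lorentz_integral p q (HL_maximal_rV g) <=
  maximal_const%:E * lorentz_integral p q g.
Proof.
move=> mg; have /andP[r0 r1] := ratio_itv.
have maxc0 : (0 < maximal_const)%R by rewrite divr_gt0// subr_gt0.
have [->|gfin] := eqVneq (lorentz_integral p q g) +oo.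
  by rewrite gt0_muley ?lte_fin// leey.
have rk0 k : 0 <= (ratio ^+ k)%:E by rewrite lee_fin exprn_ge0.
have mI := measurable_itv (`]0%R, +oo[ : interval R).
have mG f c : (0 < c)%R -> measurable_fun (`]0%R, +oo[%classic : set R)
    (fun t => lorentz_density p q f (c * t)).
  move=> c_gt0; have mc : measurable_fun (`]0%R, +oo[%classic : set R) ( *%R c).
    exact: mulrl_measurable.
  apply: (measurable_comp _ _ (measurable_lorentz_density p q f mI) mc) => //.
  by move=> _ [t /= + <-]; rewrite !in_itv/= !andbT => t0; rewrite mulr_gt0.
rewrite /lorentz_integral -(integral_scale_dt_over_t dilation_gt0); last 2 first.
- exact: measurable_lorentz_density.
- by move=> t; exact: lorentz_density_ge0.
pose u k t := (ratio ^+ k)%:E * lorentz_density p q g ((2 ^+ k)^-1 * t).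
have u0 k t : 0 <= u k t by rewrite mule_ge0 ?lorentz_density_ge0.
have i2 k : (0 < (2 ^+ k)^-1 :> R)%R by rewrite invr_gt0 exprn_gt0.
have mu_ k : measurable_fun (`]0%R, +oo[%classic : set R) (u k).
  by apply: measurable_funeM; exact: mG.
have mS : measurable_fun (`]0%R, +oo[%classic : set R) (fun t => \sum_(k <oo) u k t).
  by apply: ge0_emeasurable_sum => // k t _ _.
apply: (@le_trans _ _ (\int[@lebesgue_measure R]_(t in `]0%R, +oo[)
    (dilation_const%:E * (\sum_(k <oo) u k t) * (t^-1)%:E))).
  apply: (le_integral_dt_over_t (F := fun t => lorentz_density p q (HL_maximal_rV g) (dilation * t))
    (G := fun t => dilation_const%:E * (\sum_(k <oo) u k t))).
  - exact: mG.
  - exact: measurable_funeM.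
  - by move=> t; exact: lorentz_density_ge0.
  - by move=> t t0; exact: lorentz_density_HL_le.
under eq_integral do rewrite -muleA.
have pos t : (`]0%R, +oo[%classic : set R) t -> 0 <= (t^-1)%:E.
  by rewrite /= in_itv/= andbT => t0; rewrite lee_fin invr_ge0 ltW.
have mSt := measurable_dt_over_t mS.
rewrite ge0_integralZl//; last 2 first.
- by move=> t t0; rewrite mule_ge0 ?pos// nneseries_ge0.
- by rewrite lee_fin ltW.
rewrite /maximal_const EFinM -muleA lee_wpmul2l ?lee_fin ?(ltW dilation_const_gt0)//.
rewrite (_ : \int[_]_(t in _) _ = \int[@lebesgue_measure R]_(t in `]0%R, +oo[)
   (\sum_(k <oo) (u k t * (t^-1)%:E))); last first.
  apply: eq_integral => t; rewrite inE => /pos t0.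
  by rewrite muleC -nneseriesZl//; apply: eq_eseriesr => k _; rewrite muleC.
rewrite integral_nneseries//; last 2 first.
- by move=> k; exact: measurable_dt_over_t.
- by move=> k t /pos t0; rewrite mule_ge0.
rewrite (_ : \sum_(k <oo) _ = \sum_(k <oo) (lorentz_integral p q g * (ratio ^+ k)%:E)); last first.
  apply: eq_eseriesr => k _; rewrite /u.
  under eq_integral do rewrite -muleA.
  rewrite ge0_integralZl//; last 2 first.
  - by apply: measurable_dt_over_t; exact: mG.
  - by move=> t /pos t0; rewrite mule_ge0// lorentz_density_ge0.
  rewrite muleC /lorentz_integral.
  rewrite (integral_scale_dt_over_t (i2 k) (measurable_lorentz_density p q g mI))//.
  by move=> t; exact: lorentz_density_ge0.
have gE : lorentz_integral p q g = (fine (lorentz_integral p q g))%:E.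
  by rewrite fineK// ge0_fin_numE ?lorentz_integral_ge0// ltey.
rewrite gE; under eq_eseriesr do rewrite -EFinM.
by rewrite nneseries_geometric// -[X in _ <= _ * X]/(lorentz_integral p q g) gE -EFinM mulrC.
Qed.

Lemma lorentz_integral_HL_bounded : exists2 C : R, (0 < C)%R &
  forall g, measurable_fun [set: E] g ->
    lorentz_integral p q (HL_maximal_rV g) <= C%:E * lorentz_integral p q g.
Proof.
exists maximal_const; last exact: lorentz_integral_HL_le.
by rewrite divr_gt0// subr_gt0; have /andP[] := ratio_itv.
Qed.

End lorentz_maximal.

(* Near 0 the integrand t^(a-1) is dominated by t^-del with 0 < del < 1, whose
   level sets shrink geometrically, so [integral_superlevel_le] applies. *)
Lemma power_integral_finite {R : realType} (a : R) : 0 < a ->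
  exists2 J : R, 0 <= J &
  (\int[@lebesgue_measure R]_(t in `]0%R, +oo[)
    ((if t < 1 then t `^ a else 0)%R%:E * (t^-1)%:E) <= J%:E)%E.
Proof.
(* At least 1 - a, so that t^-del dominates t^(a-1) on ]0,1[; at least 1/2, so that 2^del > 1; and
   below 1, so that 2^del < 2. *)
move=> a0; pose del : R := Num.max (1 - a) (2^-1).
have del0 : 0 < del by rewrite lt_max invr_gt0 ltr0n orbT.
have del1 : del < 1 by rewrite gt_max invf_lt1 ?ltr1n// andbT ltrBlDr ltrDl.
(* With this base, t^-del > b^k means t < 2^-k, which is the decay of level sets required with A = t
   = 1. *)
pose b : R := 2 `^ del.
have b2 : b < 2.
  rewrite -[X in _ < X](@powRr1 R 2)// /b /powR gt_eqF// ltr_expR.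
  by rewrite ltr_pM2r ?ln_gt0 ?ltr1n.
have b1 : 1 < b.
  rewrite -(powRr0 2) /b /powR gt_eqF// ltr_expR.
  by rewrite ltr_pM2r ?ln_gt0 ?ltr1n.
pose I : set R := `]0, 1[%classic.
pose g0 (t : R) : \bar R := (t `^ (- del))%:E.
have mg0 : measurable_fun [set: R] g0.
  by apply/measurable_EFinP; exact: measurable_powR.
have mI : measurable I by exact: measurable_itv.
have mg : measurable_fun [set: R] (g0 \_ I) by exact: measurable_funT_restrict.
have gI t : I t -> (g0 \_ I) t = (t `^ (- del))%:E.
  by move=> It; rewrite patchE mem_set.
have gI0 t : ~ I t -> (g0 \_ I) t = 0%E.
  by move=> It; rewrite patchE memNset.
have hk (k : nat) : (@lebesgue_measure R [set x | (b ^+ k * 1)%:E < `|(g0 \_ I) x|]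
    <= (1 / 2 ^+ k)%:E)%E.
  have k0 : 0 < 1 / 2 ^+ k :> R by rewrite divr_gt0// exprn_gt0.
  apply: (@le_trans _ _ (@lebesgue_measure R `]0%R, (1 / 2 ^+ k)%R]%classic)); last first.
    by rewrite lebesgue_measure_itv/= lte_fin k0 sube0.
  apply: le_measure; rewrite ?inE; [exact: measurable_superlevel|exact: measurable_itv|].
  move=> t /=; have [It|nIt] := pselect (I t); last first.
    by rewrite gI0//= normr0 lte_fin ltNge mulr1 exprn_ge0// ltW// (lt_trans ltr01).
  rewrite gI//; move: It; rewrite /I/= !in_itv/= => /andP[t0 t1].
  rewrite t0/= mulr1 lte_fin ger0_norm ?powR_ge0// powRN -invr_powR ?(ltW t0)//.
  rewrite /b -exprn_powR// => bt; rewrite leNgt; apply/negP => tk.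
  move: bt; apply/negP; rewrite -leNgt.
  apply: ge0_ler_powR; rewrite ?nnegrE ?(ltW del0) ?exprn_ge0//.
    by rewrite invr_ge0 ltW.
  by rewrite -[leRHS]invrK lef_pV2 ?posrE ?invr_gt0 ?exprn_gt0// -div1r ltW.
have := @integral_superlevel_le _ (measurableTypeR R) _ (@lebesgue_measure R) _ b 1 1 mg.
rewrite b1 b2 => /(_ isT ltr01 ler01 hk) hg; exists (2 * b / (2 - b) * 1 * 1).
  by rewrite !mulr1 divr_ge0 ?subr_ge0 ?(ltW b2)// mulr_ge0// ltW// (lt_trans ltr01).
apply: le_trans hg.
rewrite [leLHS]integral_mkcond [leRHS]integral_mkcond.
have mF : measurable_fun [set: R] (fun t : R => (if t < 1 then t `^ a else 0)%:E).
  apply/measurable_EFinP; apply: measurable_fun_if => //.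
  - exact: measurable_fun_ltr.
  - exact: measurable_funTS (measurable_powR a).
have F0 (t : R) : (0 <= (if t < 1 then t `^ a else 0)%R%:E :> \bar R)%E.
  by rewrite lee_fin; case: ifP; rewrite ?powR_ge0.
apply: ge0_le_integral => //.
- move=> t _; apply: erestrict_ge0 => s /=; rewrite in_itv/= andbT => s0.
  by rewrite mule_ge0// lee_fin invr_ge0 ltW.
- apply/(measurable_restrictT _ _).1 => //; apply: measurable_dt_over_t.
  exact: measurable_funTS.
- apply/(measurable_restrictT _ _).1; first exact: measurable_superlevel.
  by apply: measurableT_comp => //; exact: measurable_funTS.
move=> t _; set rhs := leRHS.
have rhs0 : (0 <= rhs)%E by apply: erestrict_ge0 => s _; exact: abse_ge0.
rewrite patchE; case: ifPn => [|_//].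
rewrite inE/= in_itv/= andbT => t0.
have [t1|t1] := ltP t 1; last by rewrite mul0e.
rewrite /rhs patchE.
have It : I t by rewrite /I/= in_itv/= t0.
have ta : t `^ a * t^-1 <= t `^ (- del).
  rewrite -powR_inv1 ?(ltW t0)// -powRD ?(gt_eqF t0) ?implybT//.
  apply: ger_powR; first by rewrite t0 ltW.
  by rewrite lerNl opprD opprK addrC le_max lexx.
rewrite mem_set/=; last first.
  rewrite gI//= lte_fin ger0_norm ?powR_ge0// powRN invf_gt1 ?powR_gt0//.
  have p1 : 1 `^ del = 1 :> R by rewrite powR1.
  by rewrite -[ltRHS]p1; apply: gt0_ltr_powR; rewrite ?nnegrE ?(ltW t0).
by rewrite gI//= -EFinM lee_fin ger0_norm ?powR_ge0.
Qed.

(** * Means over balls controlled by the Lorentz norm *)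

Section lorentz_holder.
Context {R : realType} {n : nat}.
Local Notation V := 'rV[R]_n.+1.
Local Notation E := (lebesgue_rV R n).
Local Notation mu := (@lebesgue_measure_rV R n).
Implicit Types (f g : E -> \bar R).
Variables (p q b : R).
Hypotheses (p_gt1 : 1 < p) (q_gt0 : 0 < q) (hb : 2 `^ p^-1 < b < 2).
Hypothesis unit_ball_gt0 : (0 < fine (mu (eball (0 : V) 1)))%R.
Local Open Scope ereal_scope.

Let p_gt0 : (0 < p)%R. Proof. exact: lt_trans ltr01 p_gt1. Qed.

Lemma lorentz_norm_ge0 g : 0 <= lorentz_norm p q g.
Proof. exact: poweR_ge0. Qed.

Let decay : R := ((2 `^ (q / p) * 2) `^ q^-1)%R.

Let decay_gt0 : (0 < decay)%R.
Proof. by rewrite powR_gt0// mulr_gt0// powR_gt0. Qed.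

(** The embedding of L_(p,q) into weak L_p. The strict inequality is what [rearrangement_lt] needs
    in order to bound a superlevel set. *)
Lemma rearrangement_lt_lorentz_norm g (t nu : R) : (0 < t)%R ->
  lorentz_norm p q g < nu%:E ->
  rearrangement g t < (decay * nu / t `^ p^-1)%:E.
Proof.
move=> t0 gnu; have tp0 : (0 < t `^ p^-1)%R by rewrite powR_gt0.
rewrite mulrC EFinM lte_pdivlMl//.
have x0 : 0 <= (t `^ p^-1)%:E * rearrangement g t.
  by rewrite mule_ge0 ?rearrangement_ge0// lee_fin ltW.
rewrite -(poweRK (lt0r_neq0 q_gt0) x0).
have c0 : (0 <= 2 `^ (q / p) * 2 :> R)%R by rewrite mulr_ge0// powR_ge0.
apply: (@le_lt_trans _ _ (((2 `^ (q / p) * 2)%:E * lorentz_integral p q g) `^ q^-1)).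
  apply: le_poweR; rewrite ?poweR_ge0 ?invr_ge0 ?(ltW q_gt0)//.
  exact: lorentz_density_le_integral.
rewrite poweRM ?lee_fin ?lorentz_integral_ge0// poweR_EFin EFinM.
by rewrite lte_pmul2l// lte_fin.
Qed.

Let holder_const : R := ((2 * b / (2 - b) + 1) * decay)%R.

(** With T the volume of the ball and A = decay nu T^(-1/p), the weak L_p bound at T/2^k is 2^(k/p)
    A <= b^k A, so the layer estimate controls the part above A. The rest contributes at most A T,
    whence the added 1 in [holder_const]. *)
Lemma integral_ball_le f (x : V) (s nu : R) : measurable_fun [set: E] f ->
  (0 < s)%R -> lorentz_norm p q (f \_ (eball x s)) < nu%:E ->
  \int[mu]_(y in eball x s) `|f y| <=
  (holder_const * nu / (ball_volume (n := n) s) `^ p^-1 * ball_volume (n := n) s)%:E.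
Proof.
move=> mf s0 fnu; set T := ball_volume s; set g := f \_ _ in fnu.
have /andP[hb1 hb2] := hb.
have r2_ge1 : (1 <= 2 `^ p^-1 :> R)%R.
  by rewrite -[leLHS](powRr0 2); apply: ler_powR; rewrite ?ler1n// invr_ge0 ltW.
have b1 : (1 < b)%R by exact: le_lt_trans hb1.
have T0 : (0 < T)%R by exact: ball_volume_gt0.
have nu0 : (0 < nu)%R by rewrite -lte_fin (le_lt_trans (lorentz_norm_ge0 g)).
have Tp0 : (0 < T `^ p^-1)%R by rewrite powR_gt0.
pose A := (decay * nu / T `^ p^-1)%R.
have A0 : (0 < A)%R by rewrite divr_gt0// mulr_gt0.
have mg : measurable_fun [set: E] g.
  exact: measurable_funT_restrict (measurable_eball x s) mf.
have h (k : nat) : mu [set y | (b ^+ k * A)%:E < `|g y|] <= (T / 2 ^+ k)%:E.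
  apply: rearrangement_lt.
  have Tk0 : (0 < T / 2 ^+ k)%R by rewrite divr_gt0// exprn_gt0.
  apply: lt_le_trans (rearrangement_lt_lorentz_norm Tk0 fnu) _.
  rewrite lee_fin powRM ?(ltW T0) ?invr_ge0 ?exprn_ge0// invr_powR ?exprn_ge0// exprn_powR//.
  rewrite invfM invrK mulrA mulrC ler_pM2r//.
  by apply: lerXn2r; rewrite ?nnegrE ?powR_ge0 ?ltW// (lt_trans ltr01).
have b12 : (1 < b < 2)%R by rewrite b1.
have h1 := integral_superlevel_le mg b12 A0 (ltW T0) h.
have h2 : \int[mu]_(y in eball x s) `|g y| <=
    \int[mu]_(y in [set y | A%:E < `|g y|]) `|g y| + A%:E * mu (eball x s).
  exact: (integral_le_superlevel _ (measurable_eball x s) mg (ltW A0)).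
have <- : \int[mu]_(y in eball x s) `|g y| = \int[mu]_(y in eball x s) `|f y|.
  by apply: eq_integral => y yB; rewrite /g patchE yB.
apply: (le_trans h2); rewrite mu_eballE// -/T.
apply: (@le_trans _ _ ((2 * b / (2 - b) * A * T)%:E + A%:E * T%:E)).
  exact: leeD2r.
rewrite -EFinM -EFinD lee_fin /holder_const /A le_eqVlt; apply/orP; left; apply/eqP.
ring.
Qed.

Lemma integral_ball_lorentz_bounded : exists2 H : R, (0 < H)%R &
  forall f (x : V) (s nu : R), measurable_fun [set: E] f ->
  (0 < s)%R -> lorentz_norm p q (f \_ (eball x s)) < nu%:E ->
  \int[mu]_(y in eball x s) `|f y| <=
  (H * nu / (ball_volume (n := n) s) `^ p^-1 * ball_volume (n := n) s)%:E.
Proof.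
exists holder_const; last exact: integral_ball_le.
have /andP[hb1 hb2] := hb.
rewrite mulr_gt0// addr_gt0// divr_gt0 ?subr_gt0// mulr_gt0//.
by apply: lt_trans hb1; rewrite powR_gt0.
Qed.

End lorentz_holder.

(** * The maximal function on a fixed ball *)

Section local_estimate.
Context {R : realType} {n : nat}.
Local Notation V := 'rV[R]_n.+1.
Local Notation E := (lebesgue_rV R n).
Local Notation mu := (@lebesgue_measure_rV R n).
Implicit Types (f g : E -> \bar R).
Variables (p q lam : R).
Hypotheses (p_gt1 : 1 < p) (q_gt0 : 0 < q) (lam_n : 0 <= lam <= n.+1%:R).
Hypothesis unit_ball_gt0 : (0 < fine (mu (eball (0 : V) 1)))%R.
Local Open Scope ereal_scope.

Let p_gt0 : (0 < p)%R. Proof. exact: lt_trans ltr01 p_gt1. Qed.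

Lemma morrey_ball_lt f (L : R) (x : V) (s : R) :
  lorentz_morrey_norm p q lam f < L%:E -> (0 < s)%R ->
  lorentz_norm p q (f \_ (eball x s)) < (s `^ (lam / p) * L)%:E.
Proof.
move=> fL s0; have sl0 : (0 < s `^ (lam / p))%R by rewrite powR_gt0.
rewrite EFinM -lte_pdivrMl//; apply: le_lt_trans fL; apply: ereal_sup_ubound.
by exists x => //; exists s; rewrite ?powRN//= in_itv/= s0.
Qed.

(* This is where [lam <= n] enters: the bound on the mean over a ball decreases
   with the radius. *)
Lemma morrey_mean_decreasing (r s : R) : (0 < r)%R -> (r <= s)%R ->
  (s `^ (lam / p) / (ball_volume (n := n) s) `^ p^-1 <=
   r `^ (lam / p) / (ball_volume (n := n) r) `^ p^-1)%R.
Proof.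
move=> r0 rs; have s0 : (0 < s)%R by exact: lt_le_trans rs.
have /andP[_ ln] := lam_n.
(* Gathers all powers of the radius into the single exponent lam - n.+1, which is nonpositive. *)
have E t : (0 < t)%R -> (t `^ (lam / p) / (ball_volume (n := n) t) `^ p^-1 =
    (t `^ (lam - n.+1%:R) / fine (mu (eball (0 : V) 1))) `^ p^-1)%R.
  move=> t0; rewrite powRrM -invr_powR; last by rewrite ltW// ball_volume_gt0.
  rewrite -powRM ?powR_ge0 ?invr_ge0//; last by rewrite ltW// ball_volume_gt0.
  rewrite /ball_volume invfM mulrA powRB ?(gt_eqF t0) ?implybT//.
  by rewrite powR_mulrn// ltW.
rewrite (E _ s0) (E _ r0); apply: ge0_ler_powR; rewrite ?nnegrE.
- by rewrite invr_ge0 ltW.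
- by rewrite mulr_ge0 ?powR_ge0// invr_ge0 ltW.
- by rewrite mulr_ge0 ?powR_ge0// invr_ge0 ltW.
rewrite ler_pM2r ?invr_gt0// -opprB !powRN lef_pV2 ?posrE ?powR_gt0//.
by apply: ge0_ler_powR; rewrite ?nnegrE ?subr_ge0 ?(ltW r0) ?(ltW s0).
Qed.

(** Let s be the radius of a ball around x with mean above m. If s <= r the ball lies in the doubled
    ball and the restriction is invisible; if s > r the mean is at most the bound at radius r, hence
    at most m, a contradiction. *)
Lemma HL_maximal_local f (x0 : V) (r H L m : R) (x : V) :
  (0 < H)%R -> (0 < L)%R ->
  (forall (y : V) (s nu : R), (0 < s)%R ->
    lorentz_norm p q (f \_ (eball y s)) < nu%:E ->
    \int[mu]_(z in eball y s) `|f z| <=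
    (H * nu / (ball_volume (n := n) s) `^ p^-1 * ball_volume (n := n) s)%:E) ->
  lorentz_morrey_norm p q lam f < L%:E -> (0 < r)%R -> eball x0 r x ->
  (H * (r `^ (lam / p) * L) / (ball_volume (n := n) r) `^ p^-1 <= m)%R ->
  m%:E < HL_maximal_rV f x ->
  m%:E < HL_maximal_rV (f \_ (eball x0 (2 * r))) x.
Proof.
move=> H0 L0 hH fL r0 x0x Lm /(HL_maximal_gtP unit_ball_gt0)[s s0 ms].
have [sr|rs] := leP s r.
  apply/(HL_maximal_gtP unit_ball_gt0); exists s => //.
  suff -> : \int[mu]_(y in eball x s) `|(f \_ (eball x0 (2 * r))) y| =
    \int[mu]_(y in eball x s) `|f y| by [].
  apply: eq_integral => y; rewrite inE => xy; rewrite patchE mem_set//.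
  apply: (@eball_subset _ _ x x0 s) xy.
  by move: x0x; rewrite eballE/= => x0x; lra.
have := lt_le_trans ms (hH _ _ _ s0 (morrey_ball_lt x fL s0)).
rewrite lte_fin ltr_pM2r ?ball_volume_gt0// ltNge => /negP[]; apply: le_trans Lm.
have E2 (u v : R) : (H * (u * L) / v = H * L * (u / v))%R.
  by rewrite [(u * L)%R]mulrC !mulrA.
rewrite (E2 (s `^ (lam / p))%R) (E2 (r `^ (lam / p))%R) ler_pM2l ?mulr_gt0//.
exact: morrey_mean_decreasing r0 (ltW rs).
Qed.

(* To be read with h = Mf on a ball B, g the maximal function of f restricted to
   the doubled ball, and Lam the bound on the means over balls of larger radius. *)
Lemma rearrangement_local g h (B : set E) (T Lam t : R) : (0 < t)%R ->
  mu B <= T%:E ->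
  (forall x, B x -> forall m : R, (Lam <= m)%R -> m%:E < h x -> m%:E < g x) ->
  (forall x, 0 <= g x) -> (forall x, 0 <= h x) ->
  rearrangement (h \_ B) (2 * t) <=
  maxe (rearrangement g t) (if (t < T)%R then Lam else 0)%R%:E.
Proof.
move=> t0 BT hg g0 h0.
have le2 : t%:E <= (2 * t)%:E by rewrite lee_fin; lra.
apply: lee_real_upper_bounds => [|m]; first by rewrite le_max rearrangement_ge0.
rewrite gt_max => /andP[gm Lm].
have m0 : (0 < m)%R by rewrite -lte_fin (le_lt_trans (rearrangement_ge0 g t)).
apply: rearrangement_le => //; apply: le_trans le2.
have supp x : m%:E < `|(h \_ B) x| -> B x /\ m%:E < h x.
  rewrite patchE; case: ifPn => [|_]; first by rewrite inE gee0_abs.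
  by rewrite abse0 lte_fin ltNge ltW.
move: Lm; case: ifPn => [tT|Tt]; rewrite lte_fin => Lm.
  apply: le_trans (rearrangement_lt gm); apply: le_lebesgue_measure_rV => x /=.
  by move=> /supp[Bx mx]; rewrite gee0_abs//; apply: hg mx => //; exact: ltW.
(* For t >= T the whole of [B] has measure at most t, so every positive level is admissible. *)
move: Tt; rewrite -leNgt => Tt; apply: (@le_trans _ _ (mu B)).
  by apply: le_lebesgue_measure_rV => x /= /supp[].
by apply: le_trans BT _; rewrite lee_fin.
Qed.

(** The q-th power of a maximum is at most the sum of the q-th powers, which separates [g] from the
    constant [Lam] living on t < T. Dilating by T turns the second integral into (T^(1/p) Lam)^q
    times the one over ]0,1[ bounded by [J]; the factor in front comes from evaluating at 2t. *)
Lemma lorentz_integral_local g h (B : set E) (T Lam J : R) : (0 < T)%R ->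
  (0 <= Lam)%R -> mu B <= T%:E ->
  (forall x, B x -> forall m : R, (Lam <= m)%R -> m%:E < h x -> m%:E < g x) ->
  (forall x, 0 <= g x) -> (forall x, 0 <= h x) ->
  \int[@lebesgue_measure R]_(t in `]0%R, +oo[)
    ((if t < 1 then t `^ (q / p) else 0)%R%:E * (t^-1)%:E) <= J%:E ->
  lorentz_integral p q (h \_ B) <=
  (2 `^ (q / p))%:E *
   (lorentz_integral p q g + ((T `^ p^-1 * Lam) `^ q * J)%:E).
Proof.
move=> T0 L0 BT hg g0 h0 hJ.
have mI := measurable_itv (`]0%R, +oo[ : interval R).
pose w t : \bar R := (if (t < T)%R then Lam else 0)%R%:E.
pose W (t : R) : \bar R := ((t `^ p^-1)%:E * w t) `^ q.
pose F t : R := (if t < 1 then t `^ (q / p) else 0)%R.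
have w0 t : 0 <= w t by rewrite /w lee_fin; case: ifP.
have mW : measurable_fun [set: R] W.
  apply: (measurableT_comp (measurable_poweR q)); apply: emeasurable_funM.
    by apply/measurable_EFinP; exact: measurable_powR.
  apply/measurable_EFinP; apply: measurable_fun_if => //.
  exact: measurable_fun_ltr.
have mF : measurable_fun [set: R] (EFin \o F).
  apply/measurable_EFinP; apply: measurable_fun_if => //.
  - exact: measurable_fun_ltr.
  - exact: measurable_funTS (measurable_powR (q / p)).
have F0 t : 0 <= (F t)%:E by rewrite lee_fin /F; case: ifP; rewrite ?powR_ge0.
have pos t : (`]0%R, +oo[%classic : set R) t -> 0 <= (t^-1)%:E.
  by rewrite /= in_itv/= andbT => t0; rewrite lee_fin invr_ge0 ltW.
have WJ : \int[@lebesgue_measure R]_(t in `]0%R, +oo[) (W t * (t^-1)%:E) <=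
    ((T `^ p^-1 * Lam) `^ q * J)%:E.
  rewrite -(integral_scale_dt_over_t T0); last 2 first.
  - exact: measurable_funTS.
  - by move=> t; exact: poweR_ge0.
  rewrite EFinM; apply: le_trans (lee_wpmul2l _ hJ); last by rewrite lee_fin powR_ge0.
  rewrite -ge0_integralZl//; last 3 first.
  - by apply: (measurable_dt_over_t (F := EFin \o F)); exact: measurable_funTS.
  - by move=> t t0; rewrite mule_ge0 ?pos//; exact: F0.
  - by rewrite lee_fin powR_ge0.
  rewrite le_eqVlt; apply/orP; left; apply/eqP; apply: eq_integral => t.
  rewrite inE/= in_itv/= andbT => t0; rewrite muleA; congr *%E.
  rewrite /W /w gtr_pMr//; case: ifPn => _; last first.
    by rewrite !mule0 poweR0r// gt_eqF.
  rewrite -(EFinM ((T * t) `^ p^-1)) poweR_EFin -(EFinM ((T `^ p^-1 * Lam) `^ q)).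
  have Tt0 : (0 <= T `^ p^-1 * Lam)%R by rewrite mulr_ge0// powR_ge0.
  rewrite [(q / p)%R]mulrC powRrM -powRM ?powR_ge0//.
  by rewrite powRM ?(ltW T0) ?(ltW t0)// mulrAC.
have mg : measurable_fun (`]0%R, +oo[%classic : set R) (lorentz_density p q g).
  exact: measurable_lorentz_density.
have mh : measurable_fun (`]0%R, +oo[%classic : set R)
    (fun t => lorentz_density p q (h \_ B) (2 * t)).
  have mc : measurable_fun (`]0%R, +oo[%classic : set R) ( *%R 2).
    exact: mulrl_measurable.
  apply: (measurable_comp _ _ (measurable_lorentz_density p q (h \_ B) mI) mc) => //.
  by move=> _ [t /= + <-]; rewrite !in_itv/= !andbT => t0; rewrite mulr_gt0.
rewrite [leLHS]/lorentz_integral -(integral_scale_dt_over_t (c := 2))//; last 2 first.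
- exact: measurable_lorentz_density.
- by move=> t; exact: lorentz_density_ge0.
have mWp : measurable_fun (`]0%R, +oo[%classic : set R) W by exact: measurable_funTS.
have msum := emeasurable_funD mg mWp.
have c0 : 0 <= (2 `^ (q / p))%:E :> \bar R by rewrite lee_fin powR_ge0.
apply: (@le_trans _ _ (\int[@lebesgue_measure R]_(t in `]0%R, +oo[)
    ((2 `^ (q / p))%:E * (lorentz_density p q g t + W t) * (t^-1)%:E))).
  apply: (le_integral_dt_over_t (F := fun t => lorentz_density p q (h \_ B) (2 * t))
    (G := fun t => (2 `^ (q / p))%:E * (lorentz_density p q g t + W t))) => //.
  - exact: measurable_funeM.
  - by move=> t; exact: lorentz_density_ge0.
  move=> t t0; rewrite /lorentz_density weighted_poweR_scale ?rearrangement_ge0//.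
  apply: lee_wpmul2l => //; rewrite /W.
  have := rearrangement_local t0 BT hg g0 h0; rewrite -/(w t).
  have [_|_] := leP (rearrangement g t) (w t) => hle.
    rewrite -[leLHS]add0e; apply: leeD; first exact: poweR_ge0.
    apply: le_poweR; first exact: ltW.
      by rewrite mule_ge0 ?rearrangement_ge0// lee_fin powR_ge0.
    by rewrite lee_wpmul2l// lee_fin powR_ge0.
  rewrite -[leLHS]adde0; apply: leeD; last exact: poweR_ge0.
  apply: le_poweR; first exact: ltW.
    by rewrite mule_ge0 ?rearrangement_ge0// lee_fin powR_ge0.
  by rewrite lee_wpmul2l// lee_fin powR_ge0.
under eq_integral do rewrite -muleA.
rewrite ge0_integralZl//; last 2 first.
- exact: (measurable_dt_over_t msum).
- by move=> t /pos t0; rewrite mule_ge0// adde_ge0 ?poweR_ge0.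
apply: lee_wpmul2l => //.
under eq_integral do rewrite ge0_muleDl ?poweR_ge0//.
rewrite ge0_integralD//.
- exact: leeD2l.
- by move=> t /pos t0; rewrite mule_ge0// poweR_ge0.
- exact: measurable_dt_over_t.
- by move=> t /pos t0; rewrite mule_ge0// poweR_ge0.
- exact: measurable_dt_over_t.
Qed.

End local_estimate.

(** * The case of a null unit ball *)

Section degenerate.
Context {R : realType} {n : nat}.
Local Notation V := 'rV[R]_n.+1.
Local Notation E := (lebesgue_rV R n).
Local Notation mu := (@lebesgue_measure_rV R n).
Local Open Scope ereal_scope.

Lemma HL_maximal_null (f : E -> \bar R) : fine (mu (eball (0 : V) 1)) = 0%R ->
  HL_maximal_rV f = cst 0.
Proof.
move=> v0; apply/funext => x; apply/eqP; rewrite eq_le; apply/andP; split.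
  apply: ge_ereal_sup => _ [r /= r0 <-]; move: r0; rewrite in_itv/= andbT => r0.
  by rewrite mu_eball// fineM ?mu_eball_fin// v0 mulr0 invr0 mul0e.
exact: HL_maximal_ge0.
Qed.

Lemma lorentz_morrey_norm_ge0 (p q lam : R) (f : E -> \bar R) :
  0 <= lorentz_morrey_norm p q lam f.
Proof.
have mem1 : [set (r `^ (- (lam / p)))%:E * lorentz_norm p q (f \_ (eball x r))
    | x in [set: E] & r in `]0%R, +oo[]
    ((1 `^ (- (lam / p)))%:E * lorentz_norm p q (f \_ (eball (0 : V) 1))).
  by exists (0%R : V) => //; exists 1%R => //=; rewrite in_itv/= ltr01.
apply: le_trans (ereal_sup_ubound mem1).
by rewrite mule_ge0 ?poweR_ge0// lee_fin powR_ge0.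
Qed.

Lemma lorentz_norm0 (p q : R) : (0 < q)%R ->
  lorentz_norm p q (cst 0 : E -> \bar R) = 0.
Proof.
move=> q0; have r0 t : (0 < t)%R -> rearrangement (cst 0 : E -> \bar R) t = 0.
  move=> t0; apply/eqP; rewrite eq_le rearrangement_ge0 andbT.
  apply: lee_real_upper_bounds => // m m0; apply: rearrangement_le => //.
  rewrite [X in mu X](_ : _ = set0) ?measure0 ?lee_fin ?ltW//.
  apply/seteqP; split => x //=.
  by rewrite normr0 lte_fin ltNge ltW.
rewrite lorentz_normE /lorentz_integral integral0_eq.
  by rewrite poweR0r// invr_neq0// gt_eqF.
move=> t /=; rewrite in_itv/= andbT => t0.
by rewrite /lorentz_density r0// mule0 poweR0r ?mul0e// gt_eqF.
Qed.

Lemma lorentz_morrey_norm0 (p q lam : R) : (0 < q)%R ->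
  lorentz_morrey_norm p q lam (cst 0 : E -> \bar R) = 0.
Proof.
move=> q0; apply/eqP; rewrite eq_le lorentz_morrey_norm_ge0 andbT.
apply: ge_ereal_sup => _ [x _] [r _ <-].
rewrite (_ : _ \_ _ = cst 0) ?lorentz_norm0 ?mule0//.
by apply/funext => y; rewrite patchE; case: ifP.
Qed.

End degenerate.

(** * From a fixed ball to the Morrey norm *)

(** On a ball of radius r both contributions, from the doubled ball and from larger balls, are
    multiples of (r^(lam/p) L)^q, so the Morrey weight makes the bound uniform in r. *)
Lemma lorentz_morrey_HL_le {R : realType} {n : nat} (p q lam : R) :
  1 < p -> 0 < q -> 0 <= lam <= n.+1%:R ->
  0 < fine (@lebesgue_measure_rV R n (eball (0 : 'rV[R]_n.+1) 1)) ->
  exists2 C : R, 0 < C & forall (f : lebesgue_rV R n -> \bar R) (L : R),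
    measurable_fun [set: lebesgue_rV R n] f ->
    (lorentz_morrey_norm p q lam f < L%:E)%E ->
    (lorentz_morrey_norm p q lam (HL_maximal_rV f) <= (C * L)%:E)%E.
Proof.
move=> p1 q0 lamn v0; have p0 : 0 < p by exact: lt_trans p1.
have [b hb] := exists_power_base p1.
have [K K0 hK] := lorentz_integral_HL_bounded p1 q0 hb v0.
have [H H0 hH] := integral_ball_lorentz_bounded p1 q0 hb v0.
have [J J0 hJ] := power_integral_finite (divr_gt0 q0 p0).
have l20 : 0 < 2 `^ (lam / p) :> R by rewrite powR_gt0.
(* [K] bounds M on L_(p,q) and comes with the Morrey growth 2^(lam/p) of the doubled ball; H^q J is
   the share of the larger balls; the outer factor is that of [lorentz_integral_local]. *)
pose c : R := 2 `^ (q / p) * (K * (2 `^ (lam / p)) `^ q + H `^ q * J).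
have c0 : 0 < c.
  rewrite mulr_gt0 ?powR_gt0// ltr_wpDr//; first by rewrite mulr_ge0 ?powR_ge0.
  by rewrite mulr_gt0// powR_gt0.
exists (c `^ q^-1); first by rewrite powR_gt0.
move=> f L mf fL.
have L0 : 0 < L by rewrite -lte_fin (le_lt_trans (lorentz_morrey_norm_ge0 p q lam f)).
apply: ge_ereal_sup => _ [x0 _] [r /= r0 <-].
move: r0; rewrite in_itv/= andbT => r0.
have rl0 : 0 < r `^ (lam / p) by rewrite powR_gt0.
set B := eball x0 r; pose B2 := eball x0 (2 * r).
have r20 : 0 < 2 * r by rewrite mulr_gt0.
have mf1 : measurable_fun [set: lebesgue_rV R n] (f \_ B2).
  exact: (measurable_funT_restrict (measurable_eball x0 (2 * r)) mf).
have T0 := ball_volume_gt0 v0 r0; set T := ball_volume r in T0.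
have Tp0 : 0 < T `^ p^-1 by rewrite powR_gt0.
pose Lam := H * (r `^ (lam / p) * L) / T `^ p^-1.
have Lam0 : 0 <= Lam by rewrite ltW// divr_gt0// !mulr_gt0.
have BT : (lebesgue_measure_rV B <= T%:E)%E by rewrite /B mu_eballE.
have loc x : B x -> forall m : R, Lam <= m -> (m%:E < HL_maximal_rV f x)%E ->
    (m%:E < HL_maximal_rV (f \_ B2) x)%E.
  move=> Bx m Lm; apply: (HL_maximal_local p1 lamn v0 H0 L0 _ fL r0 Bx Lm).
  by move=> y s nu; exact: hH.
have h1 := lorentz_integral_local q0 T0 Lam0 BT loc (HL_maximal_ge0 _) (HL_maximal_ge0 _) hJ.
have f1N : (lorentz_integral p q (f \_ B2) <= (((2 * r) `^ (lam / p) * L) `^ q)%:E)%E.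
  have := ltW (morrey_ball_lt x0 fL r20) => N.
  rewrite -[leLHS](@poweRK _ _ q^-1) ?invr_neq0 ?gt_eqF ?lorentz_integral_ge0//.
  rewrite invrK -poweR_EFin; apply: le_poweR N; first exact: ltW.
  exact: poweR_ge0.
have h2 : (lorentz_integral p q ((HL_maximal_rV f) \_ B) <=
    ((c `^ q^-1 * (r `^ (lam / p) * L)) `^ q)%:E)%E.
  apply: (le_trans h1).
  apply: (@le_trans _ _ ((2 `^ (q / p))%:E *
    (K%:E * (((2 * r) `^ (lam / p) * L) `^ q)%:E + ((T `^ p^-1 * Lam) `^ q * J)%:E))%E).
    apply: lee_wpmul2l; first by rewrite lee_fin powR_ge0.
    apply: leeD2r; apply: le_trans (hK _ mf1) _.
    by apply: lee_wpmul2l => //; rewrite lee_fin ltW.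
  rewrite -(EFinM K) -(EFinD (K * _)) -(EFinM (2 `^ (q / p))) lee_fin.
  (* The volume of the ball drops out here, leaving only the Morrey growth of the radius. *)
  have -> : T `^ p^-1 * Lam = H * (r `^ (lam / p) * L).
    by rewrite /Lam mulrC divfK// gt_eqF.
  rewrite (@powRM _ 2 r) ?(ltW r0)// -(mulrA (2 `^ (lam / p))).
  have rL : 0 <= r `^ (lam / p) * L by rewrite mulr_ge0// ltW.
  rewrite (powRM _ (ltW l20) rL) (powRM _ (ltW H0) rL) (powRM _ (powR_ge0 _ _) rL).
  rewrite -(powRrM c) mulVf ?gt_eqF// powRr1 ?(ltW c0)//.
  by rewrite /c le_eqVlt; apply/orP; left; apply/eqP; ring.
rewrite powRN lee_pdivrMl// -EFinM lorentz_normE.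
have cL0 : 0 <= c `^ q^-1 * (r `^ (lam / p) * L).
  by rewrite mulr_ge0 ?powR_ge0// mulr_ge0// ltW.
apply: (@le_trans _ _ (((c `^ q^-1 * (r `^ (lam / p) * L)) `^ q)%:E `^ q^-1)%E).
  by apply: le_poweR; rewrite ?invr_ge0 ?(ltW q0) ?lorentz_integral_ge0.
rewrite poweR_EFin -powRrM mulfV ?gt_eqF// powRr1// lee_fin.
by rewrite le_eqVlt; apply/orP; left; apply/eqP; ring.
Qed.

Theorem theorem3p1 (R : realType) (n : nat) (p q lam : R)
    (hp : 1 < p) (hq : 1 <= q) (hlam : 0 <= lam <= n.+1%:R) :
  exists C : R, 0 < C /\
    forall f : lebesgue_rV R n -> \bar R, lorentz_morrey p q lam f ->
      lorentz_morrey p q lam (HL_maximal_rV f) /\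
      (lorentz_morrey_norm p q lam (HL_maximal_rV f)
         <= C%:E * lorentz_morrey_norm p q lam f)%E.
Proof.
have q0 : 0 < q by exact: lt_le_trans hq.
have := fine_ge0 (measure_ge0 (@lebesgue_measure_rV R n) (eball (0 : 'rV[R]_n.+1) 1)).
(* If the unit ball were null, Mf would vanish identically and C = 1 would do. *)
rewrite le_eqVlt => /predU1P[/esym v0|v0].
  exists 1; split; first exact: ltr01.
  move=> f [mf fN]; rewrite (HL_maximal_null f v0).
  have N0 := @lorentz_morrey_norm0 R n p q lam q0.
  split; last by rewrite N0 mul1e; exact: lorentz_morrey_norm_ge0.
  by split; [exact: measurable_cst|rewrite N0].
have [C C0 hC] := lorentz_morrey_HL_le hp q0 hlam v0.
exists C; split; first exact: C0.
move=> f [mf fN].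
have le : (lorentz_morrey_norm p q lam (HL_maximal_rV f)
         <= C%:E * lorentz_morrey_norm p q lam f)%E.
  rewrite -lee_pdivrMl//; apply: lee_real_upper_bounds => [|L fL].
    exact: lorentz_morrey_norm_ge0.
  by rewrite lee_pdivrMl// -EFinM; exact: hC.
split; last exact: le.
split; first exact: (measurable_HL_maximal v0).
apply: le_lt_trans le _; rewrite -ge0_fin_numE.
  by rewrite fin_numM// ge0_fin_numE// lorentz_morrey_norm_ge0.
by rewrite mule_ge0 ?lorentz_morrey_norm_ge0// lee_fin ltW.
Qed.
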